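(* Let $\sigma_l>\sigma_t>0$ and $\lambda>0$ be real constants, and let $(a,b)$ be either $(\sigma_l,\sigma_t)$ or $(\sigma_t,\sigma_l)$. For $\mathbf{x}=(x_1,x_2),\mathbf{y}=(y_1,y_2)\in\mathbb{R}^2$ put $$r^{(a,b)}(\mathbf{x},\mathbf{y})=\sqrt{\frac{(x_1-y_1)^2}{a}+\frac{(x_2-y_2)^2}{b}},\qquad u^{*}(\mathbf{x},\mathbf{y};\lambda)=\frac{1}{4\sqrt{\sigma_l\sigma_t}}\,N_0\bigl(\lambda\, r^{(a,b)}(\mathbf{x},\mathbf{y})\bigr)\quad(\mathbf{x}\neq\mathbf{y}).$$ Then for every $\mathbf{x}\in\mathbb{R}^2$ the function $\mathbf{y}\mapsto u^{*}(\mathbf{x},\mathbf{y};\lambda)$ satisfies, in the sense of distributions on $\mathbb{R}^2$ in the variable $\mathbf{y}$, $$a\,\frac{\partial^2 u^{*}}{\partial y_1^2}+b\,\frac{\partial^2 u^{*}}{\partial y_2^2}+\lambda^2u^{*}=\delta(\mathbf{x}-\mathbf{y}),$$ that is, it is a fundamental solution of the anisotropic Helmholtz operator. Moreover, for all $\mathbf{x}\neq\mathbf{y}$ and every unit vector $\mathbf{n}\in\mathbb{R}^2$, $$\left(a\frac{\partial u^{*}}{\partial y_1}(\mathbf{x},\mathbf{y};\lambda),\,b\frac{\partial u^{*}}{\partial y_2}(\mathbf{x},\mathbf{y};\lambda)\right)\cdot\mathbf{n}=\frac{\lambda}{4\sqrt{\sigma_l\sigma_t}}\,\frac{(\mathbf{x}-\mathbf{y})\cdot\mathbf{n}}{r^{(a,b)}(\mathbf{x},\mathbf{y})}\,N_1\bigl(\lambda\,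 r^{(a,b)}(\mathbf{x},\mathbf{y})\bigr).$$
   Context: $N_0$ and $N_1$ denote the Bessel functions of the second kind (Neumann functions, also written $Y_0$, $Y_1$) of orders zero and one. $\delta(\mathbf{x}-\mathbf{y})$ denotes the Dirac delta, as a distribution in $\mathbf{y}$ concentrated at $\mathbf{y}=\mathbf{x}$. *)

(* Defs.v *)
From HB Require Import structures.
From mathcomp Require Import all_boot all_order all_algebra.
From mathcomp Require Import all_classical all_reals all_analysis.
Set Implicit Arguments.
Unset Strict Implicit.
Unset Printing Implicit Defensive.
Import Order.TTheory GRing.Theory Num.Theory.
Import numFieldNormedType.Exports.
Local Open Scope classical_set_scope.
Local Open Scope ring_scope.

Section bessel.
Context {R : realType}.
Implicit Types (n k : nat) (z : R).

Definition euler_gamma : R :=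
  limn (fun n => \sum_(1 <= j < n.+1) j%:R^-1 - ln n%:R : R).

(* psi (k + 1), where psi is the digamma function. *)
Definition digammaS k : R := \sum_(1 <= j < k.+1) j%:R^-1 - euler_gamma.

Definition besselJ n z : R :=
  (z / 2) ^+ n *
  limn (series (fun k => (- (z ^+ 2 / 4)) ^+ k / (k`! * (n + k)`!)%N%:R : R)).

(* Bessel function of the second kind (Neumann function) of integer order n,
   for z > 0; this is the classical ascending series of
     N_n = lim_(nu -> n) (J_nu cos (nu pi) - J_(-nu)) / sin (nu pi).
   For z <= 0 the value is meaningless. *)
Definition besselN n z : R :=
  - ((z / 2) ^- n / pi) *
      (\sum_(0 <= k < n) (n - k - 1)`!%:R / k`!%:R * (z ^+ 2 / 4) ^+ k)
  + 2 / pi * ln (z / 2) * besselJ n z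
  - (z / 2) ^+ n / pi *
      limn (series (fun k => (digammaS k + digammaS (n + k)) *
        (- (z ^+ 2 / 4)) ^+ k / (k`! * (n + k)`!)%N%:R : R)).

End bessel.

Section distributions.
Context {R : realType}.
Implicit Types (a b lambda : R) (x y v : R * R) (u f : R * R -> R).

Definition e1 : R * R := (1, 0).
Definition e2 : R * R := (0, 1).

(* The library norm on R * R is the sup norm: Euclidean notions have to be
   spelled out through this inner product. *)
Definition dotp x y : R := x.1 * y.1 + x.2 * y.2.

Definition lebesgue2 :
    {measure set (measurableTypeR R * measurableTypeR R) -> \bar R} :=
  ((@lebesgue_measure R) \x (@lebesgue_measure R))%E.

Fixpoint Ck (k : nat) f : Prop :=
  continuous f /\
  if k is k'.+1 then
    (forall y, derivable f y e1 /\ derivable f y e2) /\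
    Ck k' ('D_e1 f) /\ Ck k' ('D_e2 f)
  else True.

Definition test_function f : Prop :=
  (forall k, Ck k f) /\ compact (closure [set y | f y != 0]).

Definition locally_integrable2 u : Prop :=
  measurable_fun setT (u : measurableTypeR R * measurableTypeR R -> R) /\
  forall K : set (R * R), compact K -> lebesgue2.-integrable K (EFin \o u).

(* Distributions on R * R are represented by functionals of which only the
   values on test functions matter, see [eq_distribution]. *)
Definition functional := (R * R -> R) -> R.

Definition eq_distribution (S T : functional) : Prop :=
  forall f, test_function f -> S f = T f.

(* A distribution only when u is locally integrable. *)
Definition regular u : functional :=
  fun f => \int[lebesgue2]_y (u y * f y).

Definition delta x : functional := fun f => f x.

Definition dderive v (T : functional) : functional := fun f => - T ('D_v f).

Definition aniso_helmholtz a b lambda (T : functional) : functional :=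
  fun f => a * dderive e1 (dderive e1 T) f + b * dderive e2 (dderive e2 T) f
           + lambda ^+ 2 * T f.

(* [P u = delta_x] in the sense of distributions, [P] being the operator
   [a d^2/dy_1^2 + b d^2/dy_2^2 + lambda^2]. *)
Definition fundamental_solution a b lambda x u : Prop :=
  locally_integrable2 u /\
  eq_distribution (aniso_helmholtz a b lambda (regular u)) (delta x).

End distributions.

Section ustar.
Context {R : realType}.
Implicit Types (a b sl st lambda : R) (x y : R * R).

Definition rdist a b x y : R :=
  Num.sqrt ((x.1 - y.1) ^+ 2 / a + (x.2 - y.2) ^+ 2 / b).

(* Only meaningful for x != y; the value on the diagonal, a null set in y, is
   irrelevant. *)
Definition ustar sl st a b lambda x y : R :=
  1 / (4 * Num.sqrt (sl * st)) * besselN 0 (lambda * rdist a b x y).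

End ustar.

(* Main.v *)
Require Import Defs.
From HB Require Import structures.
From mathcomp Require Import all_boot all_order all_algebra.
From mathcomp Require Import all_classical all_reals all_analysis.
From mathcomp Require Import measurable_realfun ring lra.
Import Order.TTheory GRing.Theory Num.Theory.
Import numFieldNormedType.Exports.
Local Open Scope classical_set_scope.
Local Open Scope ring_scope.

(** Write r for the anisotropic distance from x, kap = lambda^2 / 4 and w = kap r^2.
    Up to the factor 1 / pi, N_0 (lambda r) is Phi(w) = ln w * A(w) - B(w) with
    A, B entire, and r N_1 (lambda r) is a constant multiple of Psi(w) = w Phi'(w).
    Bessel's equation becomes Psi' = - Phi, where Psi is continuous up to w = 0
    with Psi(0) = 1 ([is_derive_besPhi], [is_derive_besPsi], [besPsi0]).  The
    formula for the conormal derivative is the chain rule and Phi' = Psi / w.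

    For the distributional equation put V(y) = Phi(w).  The gradient of V is
    O(1/r), hence locally integrable, so a single integration by parts in each
    Cartesian variable is legitimate: by Fubini it takes place on the lines
    that miss x, which are almost all of them ([ibp1], [ibp2]).  With f the
    test function this leaves
      - int (a V_1 f_1 + b V_2 f_2) + lambda^2 int V f,
    and only the derivative of f along the rays through x is involved, because
    (a V_1, b V_2) = 2 Psi(w) (y - x) / r^2.

    Use the coordinates y = x + (t s, s), in which dy = |s| ds dt
    ([integral_fan]) and w = kap q(t) s^2, with q(t) = t^2 / a + 1 / b.  On the
    ray of parameter t the integrand, with its Jacobian, is, because of Psi' = - Phi,
      - (2 / q(t)) sgn(s) d/ds [Psi(kap q(t) s^2) f(x + (t s, s))],
    whose integral over s is (4 / q(t)) f(x) ([integral_radial_ray]).  Finally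
    the integral of 1 / q is pi sqrt(a b) ([integral_ray_formV]), and the
    constant 1 / (4 sqrt(a b)) in front of N_0 makes the total equal to f(x).

    The same coordinates show that a function that is O(1/r) and has bounded
    support is integrable ([integrable_fan_bound]): the Jacobian |s| absorbs
    the singularity.  No other estimate of singular integrals is needed. *)

(** * Entire power series and the two Bessel series *)

Section entire_series.
Context {R : realType}.

Lemma is_derive_continuous (h dh : R -> R) :
  (forall u, is_derive u (1 : R) h (dh u)) -> continuous h.
Proof.
by move=> hh u; apply: differentiable_continuous; apply/derivable1_diffP; case: (hh u).
Qed.

Implicit Types (c d : R^nat) (x : R).

(** A growth condition stable under term-by-term differentiation that forces an
    infinite radius of convergence. *)
Definition factorial_decay c :=
  exists C D : R, forall n, `|c n| <= C * (D ^+ n / n`!%:R).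

Definition psum c x : R := limn (pseries c x).

Definition coef_shift c : R^nat := fun n => if n is m.+1 then c m else 0.

Lemma factorial_decay_cvg c x : factorial_decay c -> cvgn (pseries c x).
Proof.
move=> [C [D cCD]].
apply: normed_cvg.
apply: (@series_le_cvg _ _ (C *: exp_coeff (D * `|x|))) => [n|n|n|].
- exact: normr_ge0.
- rewrite /exp_coeff /GRing.scale /= /GRing.scale /= exprMn.
  rewrite [X in 0 <= X](_ : _ = C * (D ^+ n / n`!%:R) * `|x| ^+ n); last by ring.
  by rewrite mulr_ge0 ?exprn_ge0// (le_trans _ (cCD n)).
- rewrite /= normrM normrX.
  apply: le_trans (ler_wpM2r _ (cCD n)) _; first exact: exprn_ge0.
  rewrite /exp_coeff /GRing.scale /= /GRing.scale /= exprMn le_eqVlt; apply/orP; left.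
  by apply/eqP; ring.
- exact/is_cvg_seriesZ/is_cvg_series_exp_coeff.
Qed.

Lemma factorial_decay_diffs c :
  factorial_decay c -> factorial_decay (pseries_diffs c).
Proof.
move=> [C [D cCD]]; exists (C * D), D => n.
rewrite /pseries_diffs normrM normr_nat.
apply: le_trans (ler_wpM2l _ (cCD n.+1)) _; first exact: ler0n.
rewrite factS natrM exprS invfM le_eqVlt; apply/orP; left; apply/eqP.
rewrite [LHS](_ : _ = C * D * (D ^+ n / n`!%:R) * (n.+1%:R / n.+1%:R)); last by ring.
by rewrite divff ?pnatr_eq0// mulr1.
Qed.

Lemma psum_is_derive c x : factorial_decay c ->
  is_derive x (1 : R) (psum c) (psum (pseries_diffs c) x).
Proof.
move=> hc; have hd := factorial_decay_diffs _ hc.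
apply: (@pseries_snd_diffs _ c (`|x| + 1)).
- exact: factorial_decay_cvg.
- exact: factorial_decay_cvg.
- exact/factorial_decay_cvg/factorial_decay_diffs.
- by rewrite [ltRHS]ger0_norm ?ltrDl// addr_ge0.
Qed.

Lemma psum_continuous c : factorial_decay c -> continuous (psum c).
Proof.
move=> hc; apply: is_derive_continuous => x; exact: psum_is_derive.
Qed.

Lemma pseriesZ_cvg k c x : cvgn (pseries c x) ->
  pseries (fun n => k * c n) x @ \oo --> k * psum c x.
Proof.
move=> hc; rewrite [X in X @ _ --> _](_ : _ = k *: pseries c x).
  exact: cvgZl_tmp.
apply/funext => n; rewrite /pseries /GRing.scale /= /series /= scaler_sumr.
by apply: eq_bigr => i _; rewrite /GRing.scale /= mulrA.
Qed.

Lemma pseries_shift_cvg c x : cvgn (pseries c x) ->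
  pseries (coef_shift c) x @ \oo --> x * psum c x.
Proof.
move=> hc; rewrite -cvg_shiftS /=.
rewrite [X in X @ _ --> _](_ : _ = x *: pseries c x).
  exact: cvgZl_tmp.
apply/funext => n.
rewrite /pseries /GRing.scale /= /series/= big_nat_recl//= mul0r add0r.
rewrite scaler_sumr; apply: eq_bigr => i _.
by rewrite exprS /GRing.scale/=; ring.
Qed.

(** J_0(z) = A(z^2 / 4), where A is the series with coefficients [besA], and
    N_0(z) = (ln (z^2 / 4) A(z^2 / 4) - B(z^2 / 4)) / pi, where B is the series
    with coefficients [besB]. *)
Definition besA : R^nat := fun k => (-1) ^+ k / (k`! * k`!)%:R.
Definition besB : R^nat := fun k => 2 * digammaS k * besA k.

Lemma besAS k : k.+1%:R ^+ 2 * besA k.+1 = - besA k.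
Proof.
rewrite /besA factS !natrM [(-1) ^+ _]exprS.
have : k.+1%:R != 0 :> R by rewrite pnatr_eq0.
have : k`!%:R != 0 :> R by rewrite pnatr_eq0 -lt0n fact_gt0.
move: k.+1%:R k`!%:R => m f f0 m0.
by field; rewrite f0 m0.
Qed.

Lemma digammaSS k : digammaS k.+1 = digammaS k + k.+1%:R^-1 :> R.
Proof. by rewrite /digammaS big_nat_recr//= addrAC. Qed.

(** Any exponential bound will do: it is absorbed by the factorials. *)
Lemma digammaS_bound : exists C : R, forall k, `|digammaS k| <= C * 2 ^+ k.
Proof.
exists (1 + `|euler_gamma|) => k.
apply: le_trans (ler_normB _ _) _; rewrite mulrDl mul1r lerD//.
  elim: k => [|k IH]; first by rewrite big_geq// normr0.
  rewrite big_nat_recr//= exprS mulrDl mul1r (le_trans (ler_normD _ _))// lerD//.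
  rewrite ger0_norm ?invr_ge0// (@le_trans _ _ 1)//.
    by rewrite invf_le1// ler1n.
  by rewrite exprn_ege1// ler1n.
by rewrite ler_peMr// exprn_ege1// ler1n.
Qed.

Lemma besA_bound k : `|besA k| <= k`!%:R^-1.
Proof.
rewrite /besA normrM normrX normrN normr1 expr1n mul1r normfV normr_nat.
rewrite lef_pV2 ?posrE ?ltr0n ?muln_gt0 ?fact_gt0//.
by rewrite ler_nat leq_pmulr// fact_gt0.
Qed.

Lemma besA_decay : factorial_decay besA.
Proof.
by exists 1, 1 => n; rewrite expr1n !mul1r besA_bound.
Qed.

Lemma besB_decay : factorial_decay besB.
Proof.
have [C hC] := digammaS_bound.
exists (2 * C), 2 => k; rewrite /besB normrM normrM normr_nat mulrA.
rewrite ler_pM//; last exact: besA_bound.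
by rewrite -mulrA ler_wpM2l.
Qed.

Lemma psum_cvg c x : factorial_decay c -> pseries c x @ \oo --> psum c x.
Proof. exact: factorial_decay_cvg. Qed.

Lemma psum_mulX_cvg c x : factorial_decay c ->
  pseries (coef_shift c) x @ \oo --> x * psum c x.
Proof. by move=> hc; apply: pseries_shift_cvg; exact: factorial_decay_cvg. Qed.

Local Hint Resolve besA_decay besB_decay factorial_decay_diffs psum_cvg psum_mulX_cvg : core.

Local Notation A := (psum besA).
Local Notation B := (psum besB).
Local Notation A' := (psum (pseries_diffs besA)).
Local Notation B' := (psum (pseries_diffs besB)).
Local Notation A'' := (psum (pseries_diffs (pseries_diffs besA))).
Local Notation B'' := (psum (pseries_diffs (pseries_diffs besB))).

Lemma pseriesD_cvg c d x l l' : pseries c x @ \oo --> l -> pseries d x @ \oo --> l' ->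
  pseries (fun n => c n + d n) x @ \oo --> l + l'.
Proof.
move=> hc hd; rewrite (_ : pseries _ x = pseries c x \+ pseries d x); first exact: cvgD.
apply/funext => n; rewrite /pseries /series /= -big_split/=.
by apply: eq_bigr => i _; rewrite mulrDl.
Qed.

Lemma cvg_pseries0 c x l : pseries c x @ \oo --> l -> (forall n, c n = 0) -> l = 0.
Proof.
move=> /[swap] c0 /cvg_lim <- //.
rewrite (_ : pseries c x = fun=> 0) ?lim_cst//.
by apply/funext => n; rewrite /pseries/= /series /= big1// => i _; rewrite c0 mul0r.
Qed.

(** Bessel's equation of order zero in the variable w = z^2 / 4. *)
Lemma besselA_ode w : A' w + w * A'' w + A w = 0.
Proof.
have H : pseries (fun n => pseries_diffs besA n
    + coef_shift (pseries_diffs (pseries_diffs besA)) n + besA n) w @ \oo -->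
    A' w + w * A'' w + A w.
  by do 2?apply: pseriesD_cvg; auto.
apply: cvg_pseries0 H _ => -[|k]; rewrite /coef_shift /pseries_diffs.
  by have := besAS 0; rewrite expr1n addr0 => ->; rewrite addNr.
by rewrite -(opprK (besA k.+1)) -besAS -[in k.+2%:R]natr1; ring.
Qed.

Lemma besBS k : k.+1%:R ^+ 2 * besB k.+1 = - besB k + 2 * k.+1%:R * besA k.+1.
Proof.
rewrite /besB mulrCA.
have -> : 2 * k.+1%:R * besA k.+1 = 2 * k.+1%:R^-1 * (k.+1%:R ^+ 2 * besA k.+1) :> R.
  have : k.+1%:R != 0 :> R by rewrite pnatr_eq0.
  by move: k.+1%:R => m m0; field.
by rewrite besAS digammaSS; ring.
Qed.

(** The right-hand side is what the recurrence psi(k+2) - psi(k+1) = 1 / (k+1)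
    adds to the equation of A; it cancels the terms that come from
    differentiating the logarithm in [is_derive_besPsi]. *)
Lemma besselB_ode w : B' w + w * B'' w + B w = 2 * A' w.
Proof.
apply/eqP; rewrite -subr_eq0; apply/eqP.
have H : pseries (fun n => pseries_diffs besB n
    + coef_shift (pseries_diffs (pseries_diffs besB)) n + besB n
    + (- 2) * pseries_diffs besA n) w @ \oo -->
    B' w + w * B'' w + B w + (- 2) * A' w.
  by do 3?apply: pseriesD_cvg; auto; apply/pseriesZ_cvg/factorial_decay_cvg; auto.
rewrite -mulNr; apply: cvg_pseries0 H _ => -[|k]; rewrite /coef_shift /pseries_diffs.
  by have := besBS 0; rewrite expr1n addr0 => ->; ring.
have := besBS k.+1; rewrite -[in k.+2%:R]natr1 => h.
by rewrite -(opprK (besB k.+1)) -[X in - X](addrK (2 * (k.+1%:R + 1) * besA k.+2)) -h; ring.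
Qed.

End entire_series.

(** * The Neumann functions as a profile in the squared distance *)

Section bessel_profile.
Context {R : realType}.
Implicit Types (c d : R^nat) (x w z : R).
Local Hint Resolve besA_decay besB_decay factorial_decay_diffs psum_cvg psum_mulX_cvg : core.

Local Notation A := (psum besA).
Local Notation B := (psum besB).
Local Notation A' := (psum (pseries_diffs besA)).
Local Notation B' := (psum (pseries_diffs besB)).
Local Notation A'' := (psum (pseries_diffs (pseries_diffs besA))).
Local Notation B'' := (psum (pseries_diffs (pseries_diffs besB))).

Definition besPhi w : R := ln w * A w - B w.
(** The product w Phi'(w), written so that it extends continuously to w = 0. *)
Definition besPsi w : R := A w + w * ln w * A' w - w * B' w.

Lemma besPsi0 : besPsi 0 = 1.
Proof.
rewrite /besPsi !mul0r addr0 subr0; apply/cvg_lim => //.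
rewrite -cvg_shiftS /= [X in X @ _ --> _](_ : _ = fun=> 1); first exact: cvg_cst.
apply/funext => n; rewrite /pseries /series /= big_nat_recl//= big1 => [|i _].
  by rewrite /besA !expr0 !fact0 divr1 mulr1 addr0.
by rewrite exprS mul0r mulr0.
Qed.

Lemma besselN0E z : 0 <= z -> besselN 0 z = besPhi (z ^+ 2 / 4) / pi.
Proof.
move=> z0; rewrite /besselN /besPhi /besselJ; set w := z ^+ 2 / 4.
rewrite big_geq// mulr0 add0r !expr0 !mul1r.
have -> : limn (series (fun k => (- (w)) ^+ k / (k`! * (0 + k)`!)%:R)) = A (w).
  congr (limn (series _)); apply/funext => k.
  by rewrite add0n /besA -(mulN1r w) exprMn mulrAC.
have -> : limn (series (fun k => (digammaS k + digammaS (0 + k)) *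
     (- (w)) ^+ k / (k`! * (0 + k)`!)%:R)) = B (w).
  congr (limn (series _)); apply/funext => k.
  rewrite add0n /= /besB /besA -(mulN1r w) exprMn.
  by ring.
have -> : ln (w) = 2 * ln (z / 2) :> R.
  rewrite /w; move: z0; rewrite le_eqVlt => /predU1P[<-|z0].
    by rewrite expr0n/= !mul0r ln0// mulr0.
  have -> : z ^+ 2 / 4 = (z / 2) ^+ 2 by field.
  by rewrite lnXn ?divr_gt0// mulr_natl.
ring.
Qed.

(** The only difference with the series in [besPsi] lies in the digamma
    factors: psi(k+1) + psi(k+2) replaces 2 psi(k+2).  The defect 1 / (k+1)
    sums to a shifted copy of A, which supplies the missing A(w) - 1. *)
Lemma besselN1E z : 0 < z -> besselN 1 z = - (2 / (pi * z)) * besPsi (z ^+ 2 / 4).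
Proof.
move=> z0; rewrite /besselN /besPsi /besselJ big_nat1 !subn0 subnn fact0 expr0 !expr1 divr1 !mulr1.
set w := z ^+ 2 / 4.
have -> : limn (series (fun k => (- w) ^+ k / (k`! * (1 + k)`!)%:R)) = - A' w.
  apply/cvg_lim => //.
  rewrite (_ : series _ = pseries (fun n => -1 * pseries_diffs besA n) w).
    rewrite -(mulN1r (A' w)); exact/pseriesZ_cvg/factorial_decay_cvg/factorial_decay_diffs.
  congr series; apply/funext => k.
  rewrite add1n /= /pseries_diffs /besA factS !natrM -(mulN1r w) exprMn [(-1) ^+ k.+1]exprS.
  have : k.+1%:R != 0 :> R by rewrite pnatr_eq0.
  have : k`!%:R != 0 :> R by rewrite pnatr_eq0 -lt0n fact_gt0.
  by move: k.+1%:R k`!%:R => m f f0 m0; field; rewrite f0 m0.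
set D := limn _.
have wD : w * D = A w - 1 - w * B' w.
  (* The coefficients of (A(w) - 1) / w. *)
  pose aS : R^nat := fun n => besA n.+1.
  have hE : factorial_decay aS.
    exists 1, 1 => k; rewrite /aS expr1n !mul1r; apply: le_trans (besA_bound _) _.
    by rewrite lef_pV2 ?posrE ?ltr0n ?fact_gt0// ler_nat factS leq_pmull.
  have wE : w * psum aS w = A w - 1.
    apply/esym/eqP; rewrite subr_eq; apply/eqP/cvg_lim => //.
    rewrite -cvg_shiftS /= [X in X @ _ --> _](_ : _ = (fun n => w * pseries aS w n + 1)).
      by apply: cvgD; [apply: cvgM; [exact: cvg_cst|exact: psum_cvg]|exact: cvg_cst].
    apply/funext => n; rewrite /pseries /series /= big_nat_recl//= addrC; congr (_ + _).
      by rewrite mulr_sumr; apply: eq_bigr => i _; rewrite exprS mulrCA.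
    by rewrite /besA !expr0 !fact0 divr1 mulr1.
  have -> : D = - B' w + psum aS w.
    apply/cvg_lim => //.
    rewrite (_ : series _ = pseries (fun k => -1 * pseries_diffs besB k + aS k) w).
      apply: pseriesD_cvg; last by auto.
      by rewrite -(mulN1r (B' w)); exact/pseriesZ_cvg/factorial_decay_cvg/factorial_decay_diffs.
    congr series; apply/funext => k.
    rewrite add1n /= /aS /pseries_diffs /besB digammaSS -(mulN1r w) exprMn.
    rewrite /besA factS !natrM [(-1) ^+ k.+1]exprS.
    have : k.+1%:R != 0 :> R by rewrite pnatr_eq0.
    have : k`!%:R != 0 :> R by rewrite pnatr_eq0 -lt0n fact_gt0.
    by move: k.+1%:R k`!%:R => m f f0 m0; field; rewrite f0 m0.
  by rewrite mulrDr wE; ring.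
have lnw : ln w = 2 * ln (z / 2).
  rewrite /w.
  have -> : z ^+ 2 / 4 = (z / 2) ^+ 2 by field.
  by rewrite lnXn ?divr_gt0// mulr_natl.
have p0 : (pi : R) != 0 by rewrite gt_eqF// pi_gt0.
have z0' : z != 0 by rewrite gt_eqF.
have D_eq : D = (A w - 1 - w * B' w) / w.
  by rewrite -wD mulrC mulKf// /w mulf_neq0// ?expf_neq0 ?invr_neq0.
rewrite D_eq lnw /w; move: (pi : R) p0 => p p0; field.
by rewrite p0 z0'.
Qed.

(** Apply ln v < v to v = 1 / sqrt x. *)
Lemma normr_xlnx_le x : 0 < x -> x <= 1 -> `|x * ln x| <= 2 * Num.sqrt x.
Proof.
move=> x0 x1; have s0 : 0 < Num.sqrt x by rewrite sqrtr_gt0.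
have s2 : x = Num.sqrt x ^+ 2 by rewrite sqr_sqrtr// ltW.
have := ln_sublinear (_ : 0 < (Num.sqrt x)^-1); rewrite invr_gt0 lnV// => /(_ s0).
have : ln (Num.sqrt x) <= 0 by rewrite ln_le0// -sqrtr1 ler_sqrt.
have -> : `|x * ln x| = `|Num.sqrt x ^+ 2 * (ln (Num.sqrt x) *+ 2)| by rewrite -lnXn// -s2.
move: (Num.sqrt x) s0 => v v0 l0 lv.
rewrite ler0_norm; last by apply: mulr_ge0_le0; [exact/exprn_ge0/ltW|exact: mulrn_wle0].
have -> : - (v ^+ 2 * (ln v *+ 2)) = v ^+ 2 * (- ln v) * 2 by rewrite -mulr_natr; ring.
rewrite mulrC ler_pM2l// (@le_trans _ _ (v ^+ 2 * v^-1))//.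
  by rewrite ler_wpM2l ?exprn_ge0 ?ltW.
by rewrite expr2 mulfK ?gt_eqF.
Qed.

Lemma continuous_xlnx : continuous (fun x : R => x * ln x).
Proof.
move=> x; case: (ltgtP x 0) => [x0|x0|->].
- rewrite /continuous_at ln0 ?mulr0 ?ltW//.
  apply/cvgrPdist_le => e e0; near=> y; rewrite ln0 ?mulr0 ?subrr ?normr0 ?ltW//.
  by near: y; exact: lt_nbhsl.
- by apply: cvgM; [exact: cvg_id|exact: continuous_ln].
- rewrite /continuous_at mul0r.
  have s0 : (2 * Num.sqrt y : R) @[y --> 0] --> 0.
    rewrite -[X in _ --> X](mulr0 2) -[in X in _ --> X]sqrtr0.
    by apply: cvgM; [exact: cvg_cst|exact: sqrt_continuous].
  apply/cvgrPdist_le => e e0; near=> y; rewrite sub0r normrN.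
  have [y0|y0] := leP y 0; first by rewrite ln0// mulr0 normr0 ltW.
  apply: le_trans (normr_xlnx_le _ y0 _) _.
    by apply: ltW; near: y; apply: lt_nbhsl.
  rewrite -[leLHS]ger0_norm ?mulr_ge0// -normrN -sub0r.
  by near: y; move/cvgrPdist_le : s0; apply.
Unshelve. all: end_near. Qed.

Lemma besPsi_continuous : continuous besPsi.
Proof.
move=> w; apply: cvgB; last by apply: cvgM; [exact: cvg_id|apply: psum_continuous; auto].
apply: cvgD; first by apply: psum_continuous; auto.
by apply: cvgM; [exact: continuous_xlnx|apply: psum_continuous; auto].
Qed.

Lemma is_derive_besPhi w : 0 < w -> is_derive w 1 besPhi (besPsi w / w).
Proof.
move=> w0.
have w0' : w != 0 by rewrite gt_eqF.
have h1 := is_derive1_ln w0.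
have h2 := psum_is_derive besA w besA_decay.
have h3 := psum_is_derive besB w besB_decay.
rewrite (_ : besPhi = (@ln R * A) - B); last by apply/funext.
apply: is_derive_eq; rewrite /besPsi /GRing.scale /=; field.
exact: w0'.
Qed.

(** Equivalent to Bessel's equation w Phi'' + Phi' + Phi = 0. *)
Lemma is_derive_besPsi w : 0 < w -> is_derive w 1 besPsi (- besPhi w).
Proof.
move=> w0.
have w0' : w != 0 by rewrite gt_eqF.
have h1 := is_derive1_ln w0.
have h2 := psum_is_derive besA w besA_decay.
have h3 := psum_is_derive _ w (factorial_decay_diffs _ besA_decay).
have h4 := psum_is_derive _ w (factorial_decay_diffs _ besB_decay).
rewrite (_ : besPsi = A + id * @ln R * A' - id * B'); last by apply/funext.
apply: is_derive_eq; rewrite /besPhi !fctE /GRing.scale /=.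
rewrite -[B w](addKr (B' w + w * B'' w)) besselB_ode.
rewrite -[A w](addKr (A' w + w * A'' w)) besselA_ode.
field.
exact: w0'.
Qed.

Lemma besPhi_continuous w : 0 < w -> {for w, continuous besPhi}.
Proof.
move=> w0; apply: differentiable_continuous; apply/derivable1_diffP.
by case: (is_derive_besPhi w w0).
Qed.

(** The logarithmic singularity at 0 is killed by a square root, since
    sqrt w * ln w = 2 v ln v with v = sqrt w. *)
Lemma continuous_sqrt_besPhi : continuous (fun w => Num.sqrt w * besPhi w).
Proof.
have -> : (fun w => Num.sqrt w * besPhi w) =
    (fun w => 2 * (Num.sqrt w * ln (Num.sqrt w)) * A w - Num.sqrt w * B w).
  apply/funext => w; rewrite /besPhi; have [w0|w0] := ltP 0 w; last first.
    by rewrite ler0_sqrtr//; ring.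
  rewrite -[in ln w](sqr_sqrtr (ltW w0)) lnXn ?sqrtr_gt0//; ring.
move=> w; apply: cvgB; (apply: cvgM; last by apply: psum_continuous; auto).
- apply: cvgM; first exact: cvg_cst.
  by apply: (@continuous_comp _ _ _ Num.sqrt (fun x => x * ln x));
    [exact: sqrt_continuous|exact: continuous_xlnx].
- exact: sqrt_continuous.
Qed.

Lemma continuous_bounded_itv (f : R -> R) (W : R) : continuous f ->
  exists2 C : R, 0 <= C & forall w, 0 <= w <= W -> `|f w| <= C.
Proof.
move=> cf; have [W0|W0] := leP 0 W; last first.
  by exists 0 => // w /andP[w0 wW]; have := le_lt_trans (le_trans w0 wW) W0; rewrite ltxx.
have cnf : {within `[0, W], continuous (fun x => `|f x|)}.
  by apply: continuous_subspaceT => x; apply: cvg_norm; exact: cf.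
have [c _ hc] := EVT_max W0 cnf.
exists `|f c| => // w wW; apply: hc.
Qed.

(** This is, up to a factor, the derivative of Psi(k s^2); its continuity
    across s = 0 makes the fundamental theorem of calculus applicable there. *)
Lemma continuous_mul_besPhi (k : R) : 0 < k -> continuous (fun s : R => s * besPhi (k * s ^+ 2)).
Proof.
move=> k0 s.
have cs : continuous (fun s : R => k * s ^+ 2).
  by move=> t; apply: cvgM; [exact: cvg_cst|exact: exprn_continuous].
have [->|s0] := eqVneq s 0; last first.
  have h : besPhi (k * t ^+ 2) @[t --> s] --> besPhi (k * s ^+ 2).
    apply: (@continuous_comp R R R (fun s : R => k * s ^+ 2) besPhi); first exact: cs.
    by apply: besPhi_continuous; rewrite mulr_gt0// exprn_even_gt0.
  by apply: cvgM; [exact: cvg_id|exact: h].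
rewrite /continuous_at mul0r.
have h : `|(Num.sqrt k)^-1 * (Num.sqrt (k * s ^+ 2) * besPhi (k * s ^+ 2))| @[s --> 0] --> (0 : R).
  rewrite [X in _ --> X](_ : 0 =
      `|(Num.sqrt k)^-1 * (Num.sqrt (k * 0 ^+ 2) * besPhi (k * 0 ^+ 2))|); last first.
    by rewrite expr0n mulr0 sqrtr0 mul0r mulr0 normr0.
  have h : Num.sqrt (k * s ^+ 2) * besPhi (k * s ^+ 2) @[s --> 0] -->
      Num.sqrt (k * 0 ^+ 2) * besPhi (k * 0 ^+ 2).
    by apply: (@continuous_comp R R R (fun s : R => k * s ^+ 2)
        (fun w : R => Num.sqrt w * besPhi w)); [exact: cs|exact: continuous_sqrt_besPhi].
  by apply: cvg_norm; apply: cvgM; [exact: cvg_cst|exact: h].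
apply/cvgrPdist_le => e e0; near=> t.
have -> : `|0 - t * besPhi (k * t ^+ 2)| =
   `| 0 - `|(Num.sqrt k)^-1 * (Num.sqrt (k * t ^+ 2) * besPhi (k * t ^+ 2))| |.
  rewrite !sub0r !normrN normr_id sqrtrM ?ltW// sqrtr_sqr -mulrA mulKf ?gt_eqF ?sqrtr_gt0//.
  by rewrite !normrM normr_id.
by near: t; move/cvgrPdist_le : h; apply.
Unshelve. all: end_near. Qed.

Lemma besPhi_bound W : exists2 C : R, 0 <= C &
  forall w, 0 < w <= W -> `|besPhi w| <= C / Num.sqrt w.
Proof.
have [C C0 hC] := continuous_bounded_itv _ W continuous_sqrt_besPhi.
exists C => // w /andP[w0 wW]; rewrite ler_pdivlMr ?sqrtr_gt0//.
have := hC w; rewrite (ltW w0) wW normrM ger0_norm// mulrC; exact.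
Qed.

Lemma measurable_besPhi : measurable_fun setT (besPhi).
Proof.
apply: measurable_funB.
  apply: measurable_funM; first exact: measurable_ln.
  by apply: continuous_measurable_fun; apply: psum_continuous; auto.
by apply: continuous_measurable_fun; apply: psum_continuous; auto.
Qed.

End bessel_profile.

(** * Integrals over the line *)

Section line.
Context {R : realType}.
Local Notation mu := (@lebesgue_measure R).

Lemma affine_preimage_ocitv (c d a b : R) : 0 < c ->
  (fun t => c * t + d) @^-1` `]a, b] = `](a - d) / c, (b - d) / c]%classic.
Proof.
move=> c0; apply/seteqP; split => x /=; rewrite !in_itv/= => /andP[h1 h2].
  by rewrite ltr_pdivrMr// ler_pdivlMr// ![x * _]mulrC ltrBlDr h1 lerBrDr h2.
by rewrite -ltrBlDr -lerBrDr mulrC -ltr_pdivrMr// h1 -ler_pdivlMr// h2.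
Qed.

Lemma measurable_affine (c d : R) :
  measurable_fun setT ((fun t : R => c * t + d) : measurableTypeR R -> measurableTypeR R).
Proof.
apply: continuous_measurable_fun => t.
by apply: cvgD; [apply: cvgM; [exact: cvg_cst|exact: cvg_id]|exact: cvg_cst].
Qed.

(** Lebesgue measure scales by c: check it on intervals. *)
Lemma ge0_integral_affine_pos (c d : R) (f : R -> \bar R) : 0 < c -> measurable_fun setT f ->
  (forall x, 0 <= f x)%E ->
  (\int[mu]_x f x = \int[mu]_t (c%:E * f (c * t + d)%R))%E.
Proof.
move=> c0 mf f0.
rewrite ge0_integralZl//; last by rewrite lee_fin ltW.
2: exact: (measurableT_comp mf (measurable_affine c d)).
rewrite -(@ge0_integral_pushforward _ _ _ _ _ _ (measurable_affine c d) mu setT f)//.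
rewrite -[c%:E]/((NngNum (ltW c0))%:num%:E) -ge0_integral_mscale//.
  exact: measurable_affine.
move=> mphi; apply: eq_measure_integral => A mA _.
apply: lebesgue_measure_unique => //= _ [[a b]] _ <-.
rewrite /mscale/= /pushforward affine_preimage_ocitv// !lebesgue_measure_itv/= !lte_fin.
rewrite ltr_pM2r ?invr_gt0// ltrD2r; case: ifPn => _; last by rewrite mule0.
by rewrite -!EFinD -EFinM; congr EFin; field; rewrite gt_eqF.
Qed.

Lemma ge0_integral_affine (c d : R) (f : R -> \bar R) : c != 0 -> measurable_fun setT f ->
  (forall x, 0 <= f x)%E ->
  (\int[mu]_x f x = \int[mu]_t (`|c|%:E * f (c * t + d)%R))%E.
Proof.
move=> c0 mf f0; have [cp|cn] := leP 0 c.
  by rewrite ger0_norm//; apply: ge0_integral_affine_pos => //; rewrite lt_def c0.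
rewrite ltr0_norm//.
have mN : measurable_fun setT (-%R : measurableTypeR R -> measurableTypeR R).
  exact: oppr_measurable.
transitivity (\int[mu]_x f (- x)%R)%E.
  rewrite -[RHS]/(\int[mu]_(x in -%R @^-1` setT) (f \o -%R) x)%E.
  rewrite -(@ge0_integral_pushforward _ _ _ _ _ _ mN mu setT f)//.
  by apply: eq_measure_integral => A mA _; exact/esym/lebesgue_measureN.
rewrite (ge0_integral_affine_pos (- c) (- d))// ?oppr_gt0//.
  by apply: eq_integral => t _; rewrite mulNr opprD !opprK.
exact: (measurableT_comp mf mN).
Qed.

Lemma measurable_invr_ge0 d (T : measurableType d) (g : T -> R) : (forall y, 0 <= g y) ->
  measurable_fun setT g -> measurable_fun setT (fun y => (g y)^-1).
Proof.
move=> g0 mg; rewrite (_ : (fun y => _) = (fun y => g y `^ (-1))).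
  by apply: (@measurableT_comp _ _ _ _ _ _ (fun u : R => u `^ (-1))); first exact: measurable_powR.
by apply/funext => y; rewrite powR_inv1.
Qed.

Lemma eq_integral_except (p : R) (f g : R -> \bar R) :
  measurable_fun setT f -> measurable_fun setT g ->
  (forall x, x != p -> f x = g x) -> (\int[mu]_x f x = \int[mu]_x g x)%E.
Proof.
move=> mf mg fg.
have mD : measurable ([set: R] `\ p) by apply: measurableD.
rewrite -(@integral_setD1 _ f p)//; last exact: measurable_funTS.
rewrite -(@integral_setD1 _ g p)//; last exact: measurable_funTS.
by apply: eq_integral => x; rewrite inE/= => -[_ /eqP]; exact: fg.
Qed.

End line.

(** * Borel sets of the plane *)

Section plane_measurability.
Context {R : realType}.

(** An open set of the plane is a countable union of rational squares. *)
Lemma open_measurable2 (U : set (R * R)) : open U ->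
  measurable (U : set (measurableTypeR R * measurableTypeR R)).
Proof.
move=> oU.
pose sq (p q e : R) := `]p - e, p + e[%classic `*` `]q - e, q + e[%classic.
have sqE p q e : ball ((p, q) : R * R) e = sq p q e.
  apply/seteqP; split => -[x y] /=; rewrite /ball/= /ball_/= /sq /= !in_itv /= => -[].
    by rewrite -!ball_normE /ball_/= !ltr_distlC => h1 h2; split.
  by move=> h1 h2; split; rewrite -ball_normE /ball_/= ltr_distlC.
pose F (p q e : rat) : set (R * R) :=
  if `[< sq (ratr p) (ratr q) (ratr e) `<=` U >] then sq (ratr p) (ratr q) (ratr e) else set0.
have -> : U = \bigcup_p \bigcup_q \bigcup_e F p q e.
  apply/seteqP; split => [y Uy|y [p _ [q _ [e _]]]]; last first.
    by rewrite /F; case: ifPn => // /asboolP; exact.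
  have [e0 /= e0_gt0 yU] := (nbhs_ballP _ _).1 (open_nbhs_nbhs (conj oU Uy)).
  have [e] := @rat_in_itvoo R 0 (e0 / 2) (divr_gt0 e0_gt0 (ltr0n _ 2)).
  rewrite in_itv /= => /andP[ge0 ee0].
  have lt1 (x : R) : x - ratr e < x + ratr e by lra.
  have [p] := rat_in_itvoo (lt1 y.1).
  have [q] := rat_in_itvoo (lt1 y.2).
  rewrite !in_itv/= => /andP[q1 q2] /andP[p1 p2].
  exists p => //; exists q => //; exists e => //; rewrite /F; case: ifPn => [_|/asboolP []].
    by split => /=; rewrite in_itv/=; apply/andP; split; lra.
  move=> z [] /=; rewrite !in_itv/= => /andP[z1 z2] /andP[z3 z4].
  by apply: yU; split; rewrite -ball_normE /ball_/= ltr_distlC; apply/andP; split; lra.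
do 3!(apply: bigcupT_measurable_rat => ?).
rewrite /F; case: ifPn => // _.
by apply: measurableX; exact: measurable_itv.
Qed.

Lemma continuous_measurable_fun2 (f : R * R -> R) : continuous f ->
  measurable_fun setT (f : measurableTypeR R * measurableTypeR R -> R).
Proof.
move=> cf; apply: (measurability _ (RGenOInfty.measurableE R)) => //.
move=> _ [_ [x ->] <-]; rewrite setTI; apply: open_measurable2.
by apply: open_comp => // y _; exact: cf.
Qed.

Lemma compact_measurable2 (K : set (R * R)) : compact K ->
  measurable (K : set (measurableTypeR R * measurableTypeR R)).
Proof.
move=> cK; rewrite -[K]setCK; apply: measurableC; apply: open_measurable2.
by apply: closed_openC; apply: compact_closed.
Qed.

Lemma compact_bounded2 (K : set (R * R)) : compact K ->
  exists2 M : R, 0 < M & forall y, K y -> `|y.1| <= M /\ `|y.2| <= M.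
Proof.
move=> /compact_bounded[M0 [_ hM]].
exists (`|M0| + 1) => [|y /hM h].
  by rewrite ltr_pwDr.
have := h (`|M0| + 1) (_ : _); rewrite (le_lt_trans (ler_norm _))// ?ltrDl// => /(_ isT).
by rewrite /Num.norm/= /= ge_max => /andP[].
Qed.

End plane_measurability.

(** * Affine polar coordinates *)

Section fan.
Context {R : realType}.
Local Notation mu := (@lebesgue_measure R).
Local Notation plane := (measurableTypeR R * measurableTypeR R)%type.
Implicit Types (x : R * R) (h : R * R -> R).

Lemma lebesgue2_tonelli1 (f : plane -> \bar R) : measurable_fun setT f -> (forall y, 0 <= f y)%E ->
  (\int[lebesgue2]_y f y = \int[mu]_y1 \int[mu]_y2 f (y1, y2))%E.
Proof. exact: fubini_tonelli1. Qed.

Lemma lebesgue2_tonelli2 (f : plane -> \bar R) : measurable_fun setT f -> (forall y, 0 <= f y)%E ->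
  (\int[lebesgue2]_y f y = \int[mu]_y2 \int[mu]_y1 f (y1, y2))%E.
Proof. exact: fubini_tonelli2. Qed.

Lemma integral_lebesgue2_21 (h : plane -> \bar R) : lebesgue2.-integrable setT h ->
  (\int[lebesgue2]_y h y = \int[mu]_y2 \int[mu]_y1 h (y1, y2))%E.
Proof. by move=> ih; apply/esym; exact: integral21_prod_meas1. Qed.

Lemma integral_lebesgue2_12 (h : plane -> \bar R) : lebesgue2.-integrable setT h ->
  (\int[lebesgue2]_y h y = \int[mu]_y1 \int[mu]_y2 h (y1, y2))%E.
Proof. by move=> ih; apply/esym; exact: integral12_prod_meas1. Qed.

(** Polar coordinates with the angle replaced by the inverse slope t and the
    radius by the signed height s: the point x + (t s, s).  All that is
    missed is the horizontal line through x, apart from x itself; the Jacobian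
    is |s|. *)
Definition fan x (z : R * R) : R * R := (x.1 + z.1 * z.2, x.2 + z.2).

Definition fan_pull x h (z : R * R) : R := `|z.2| * h (fan x z).

Lemma measurable_fan x : measurable_fun setT (fan x : plane -> plane).
Proof.
apply: measurable_fun_pair.
  apply: measurable_funD => //.
  by apply: measurable_funM; [exact: measurable_fst|exact: measurable_snd].
by apply: measurable_funD => //; exact: measurable_snd.
Qed.

Lemma measurable_fan_pull x h : measurable_fun setT (h : plane -> R) ->
  measurable_fun setT (fan_pull x h : plane -> R).
Proof.
move=> mh; apply: measurable_funM.
  by apply: measurableT_comp => //; exact: measurable_snd.
exact: (measurableT_comp mh (measurable_fan x)).
Qed.

(** For fixed s <> 0 the change t |-> x.1 + s t is affine; then exchange the
    two integrations. *)
Lemma ge0_integral_fan x h : measurable_fun setT (h : plane -> R) -> (forall y, 0 <= h y) ->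
  (\int[lebesgue2]_y (h y)%:E = \int[lebesgue2]_z (fan_pull x h z)%:E)%E.
Proof.
move=> mh h0.
have mh' : measurable_fun setT (EFin \o h : plane -> \bar R) by exact/measurable_EFinP.
have mk' : measurable_fun setT (EFin \o fan_pull x h : plane -> \bar R).
  by apply/measurable_EFinP; apply: measurable_fan_pull.
have k0 z : 0 <= fan_pull x h z by rewrite mulr_ge0.
rewrite (lebesgue2_tonelli2 (EFin \o h))//.
rewrite (lebesgue2_tonelli2 (EFin \o fan_pull x h))//.
have mG := measurable_fun_fubini_tonelli_G (m1 := mu) (EFin \o h) mh' (fun y => h0 y).
have G0 s : (0 <= fubini_G mu (EFin \o h) s)%E by apply: integral_ge0 => t _; rewrite lee_fin.
rewrite (ge0_integral_affine 1 x.2)// ?oner_eq0//.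
apply: (eq_integral_except 0).
- apply: measurable_funeM.
  exact: (measurableT_comp mG (measurable_affine 1 x.2)).
- exact: (measurable_fun_fubini_tonelli_G (m1 := mu) (EFin \o fan_pull x h) mk' (fun y => k0 y)).
move=> s s0; rewrite normr1 mul1e mul1r /fubini_G.
rewrite (ge0_integral_affine s x.1)//.
- apply: eq_integral => t _; rewrite /= /fan_pull /fan /= -EFinM.
  by rewrite mulrC [s + _]addrC [_ + x.1]addrC [s * t]mulrC [_ * `|s|]mulrC.
- exact: (measurable_fun_pair1 (s + x.2) mh').
- by move=> t; rewrite lee_fin.
Qed.

(** Apply the nonnegative case to positive and negative parts. *)
Lemma integral_fan x h : measurable_fun setT (h : plane -> R) ->
  (\int[lebesgue2]_y (h y)%:E = \int[lebesgue2]_z (fan_pull x h z)%:E)%E.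
Proof.
move=> mh; rewrite integralE [RHS]integralE.
have pE (f : R * R -> R) : (fun y => (f y)%:E)^\+%E = (fun y => (Num.max (f y) 0)%:E).
  by apply/funext => y; rewrite funeposE EFin_max.
have nE (f : R * R -> R) : (fun y => (f y)%:E)^\-%E = (fun y => (Num.max (- f y) 0)%:E).
  by apply/funext => y; rewrite funenegE EFin_max EFinN.
rewrite !pE !nE; congr (_ - _)%E.
- rewrite (ge0_integral_fan x (fun y => Num.max (h y) 0)).
  + by apply: eq_integral => z _; rewrite /fan_pull maxr_pMr// mulr0.
  + exact: measurable_maxr.
  + by move=> y; rewrite le_max lexx orbT.
- rewrite (ge0_integral_fan x (fun y => Num.max (- h y) 0)).
  + by apply: eq_integral => z _; rewrite /fan_pull maxr_pMr// mulr0 mulrN.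
  + by apply: measurable_maxr => //; exact: measurable_funN.
  + by move=> y; rewrite le_max lexx orbT.
Qed.

Lemma integrable_fan x h : lebesgue2.-integrable setT (EFin \o h : plane -> \bar R) ->
  lebesgue2.-integrable setT (EFin \o fan_pull x h : plane -> \bar R).
Proof.
move=> /integrableP[/measurable_EFinP mh hoo]; apply/integrableP; split.
  by apply/measurable_EFinP; apply: measurable_fan_pull.
move: hoo; under eq_integral do rewrite /=.
rewrite (ge0_integral_fan x (fun y => `|h y|))//; last exact: measurableT_comp.
congr (_ < _)%E; apply: eq_integral => z _.
by rewrite /= /fan_pull normrM normr_id.
Qed.

Lemma integral_oneDsqr : (\int[mu]_t ((oneDsqr t)^-1)%:E = (pi : R)%:E)%E.
Proof.
rewrite (ge0_symfun_integralT (f := fun t => (oneDsqr t)^-1)) => [|||t].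
- rewrite -set_itvcy integral0y_oneDsqr -EFinM mulrC divfK// pnatr_eq0.
- by move=> u; rewrite invr_ge0 ltW// oneDsqr_gt0.
- exact: continuous_oneDsqrV.
- by rewrite /= /oneDsqr sqrrN.
Qed.

(** In the fan coordinates the taxicab distance to x is |s| (1 + |t|).  The
    pulled back function is thus at most C / (1 + |t|), and it is supported
    where |s| <= 2 M / (1 + |t|); its integral is dominated by that of
    4 C M / (1 + t^2). *)
Lemma integrable_fan_bound x h (C M : R) : measurable_fun setT (h : plane -> R) ->
  (forall y, `|h y| * (`|y.1 - x.1| + `|y.2 - x.2|) <= C) ->
  (forall y, h y != 0 -> `|y.1 - x.1| <= M /\ `|y.2 - x.2| <= M) ->
  lebesgue2.-integrable setT (EFin \o h : plane -> \bar R).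
Proof.
move=> mh hC hM; apply/integrableP; split; first exact/measurable_EFinP.
have C0 : 0 <= C by apply: le_trans (hC x); rewrite mulr_ge0 ?addr_ge0.
under eq_integral do rewrite /=.
have mah : measurable_fun setT ((fun y => `|h y|) : plane -> R) by exact: measurableT_comp.
rewrite (ge0_integral_fan x (fun y => `|h y|))//.
have mk' := (measurable_EFinP _ _).2 (measurable_fan_pull x _ mah).
have k0 z : 0 <= fan_pull x (fun y => `|h y|) z by rewrite mulr_ge0.
have [M0|M0] := ltP M 0.
  rewrite integral0_eq ?ltry// => z _.
  rewrite /fan_pull; have [->|/hM[/(le_trans (normr_ge0 _))]] := eqVneq (h (fan x z)) 0.
    by rewrite normr0 mulr0.
  by rewrite leNgt M0.
rewrite (lebesgue2_tonelli1 (EFin \o fan_pull x (fun y => `|h y|)))//.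
have mF := measurable_fun_fubini_tonelli_F (m2 := mu) _ mk' (fun y => k0 y).
apply: (@le_lt_trans _ _ (\int[mu]_t ((4 * C * M)%:E * ((oneDsqr t)^-1)%:E))%E); last first.
  rewrite ge0_integralZl//; last 2 first.
  - apply/measurable_EFinP; apply: continuous_measurable_fun.
    exact: continuous_oneDsqrV.
  - by rewrite lee_fin !mulr_ge0.
  by rewrite integral_oneDsqr -EFinM ltry.
apply: ge0_le_integral => //.
- by move=> t _; apply: integral_ge0 => s _; rewrite lee_fin.
- apply: measurable_funeM; apply/measurable_EFinP; apply: continuous_measurable_fun.
  exact: continuous_oneDsqrV.
move=> t _; rewrite /fubini_F.
have t1 : 0 < 1 + `|t| by rewrite ltr_pwDl.
pose B := 2 * M / (1 + `|t|).
apply: (@le_trans _ _ (\int[mu]_s ((C / (1 + `|t|))%:E * (\1_(`[- B, B]%classic) s)%:E))%E).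
  apply: ge0_le_integral => //.
  - by move=> s _; rewrite lee_fin.
  - exact: (measurable_fun_pair2 t mk').
  - by apply: measurable_funeM; apply/measurable_EFinP.
  move=> s _; rewrite -EFinM lee_fin /fan_pull /=.
  have e1 : `|h (fan x (t, s))| * (`|t * s| + `|s|) <= C.
    by have := hC (fan x (t, s)); rewrite /fan /= ![x.1 + _]addrC ![x.2 + _]addrC !addrK.
  have [h0|hn0] := eqVneq (h (fan x (t, s))) 0.
    by rewrite h0 normr0 mulr0 mulr_ge0// divr_ge0// ltW.
  have : `|t * s| <= M /\ `|s| <= M.
    by have := hM _ hn0; rewrite /fan /= ![x.1 + _]addrC ![x.2 + _]addrC !addrK.
  rewrite normrM => -[h1 h2].
  rewrite indicE mem_set ?mulr1; last first.
    rewrite /= in_itv/= -ler_norml /B ler_pdivlMr//; lra.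
  rewrite ler_pdivlMr//; move: e1; rewrite normrM; lra.
rewrite ge0_integralZl//; last by rewrite lee_fin divr_ge0// ltW.
  rewrite integral_indic// setIT /= lebesgue_measure_itv/= lte_fin.
  case: ifPn => _; last first.
    by rewrite mule0 -EFinM lee_fin mulr_ge0 ?invr_ge0 ?mulr_ge0// ltW// oneDsqr_gt0.
  rewrite -EFinD -!EFinM lee_fin /B.
  rewrite [leLHS](_ : _ = 4 * C * M * ((1 + `|t|) ^+ 2)^-1); last by field; rewrite gt_eqF.
  rewrite ler_wpM2l ?mulr_ge0// lef_pV2 ?posrE ?exprn_gt0 ?oneDsqr_gt0//.
  by rewrite /oneDsqr -[leLHS]/(1 + t ^+ 2) -real_normK ?num_real//; have := normr_ge0 t; nra.
exact/measurable_EFinP.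
Qed.

End fan.

(** * Partial derivatives *)

Section partial_derivatives.
Context {R : realType}.
Implicit Types (f : R * R -> R) (y x : R * R) (M t s : R).

Lemma continuous_slice1 (h : R * R -> R) (y2 : R) :
  continuous h -> continuous (fun u : R => h (u, y2)).
Proof.
move=> ch u; apply: (@continuous_comp R (R * R)%type R (fun u : R => (u, y2)) h); last exact: ch.
by apply: (@cvg_pair _ _ _ _ (nbhs u) (nbhs y2)); [exact: cvg_id|exact: cvg_cst].
Qed.

Lemma continuous_slice2 (h : R * R -> R) (y1 : R) :
  continuous h -> continuous (fun u : R => h (y1, u)).
Proof.
move=> ch u; apply: (@continuous_comp R (R * R)%type R (fun u : R => (y1, u)) h); last exact: ch.
by apply: (@cvg_pair _ _ _ _ (nbhs y1) (nbhs u)); [exact: cvg_cst|exact: cvg_id].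
Qed.

Lemma difference_quotient_e1 f y :
  (fun h : R => h^-1 *: ((f \o shift y) (h *: e1) - f y)) =
  (fun h : R => h^-1 *: (((fun u : R => f (u, y.2)) \o shift y.1) (h *: (1 : R))
    - (fun u : R => f (u, y.2)) y.1)).
Proof.
apply/funext => h /=; rewrite -surjective_pairing; congr (_ *: (f _ - _)).
by rewrite -[LHS]/(h * 1 + y.1, h * 0 + y.2) mulr0 add0r.
Qed.

Lemma difference_quotient_e2 f y :
  (fun h : R => h^-1 *: ((f \o shift y) (h *: e2) - f y)) =
  (fun h : R => h^-1 *: (((fun u : R => f (y.1, u)) \o shift y.2) (h *: (1 : R))
    - (fun u : R => f (y.1, u)) y.2)).
Proof.
apply/funext => h /=; rewrite -surjective_pairing; congr (_ *: (f _ - _)).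
by rewrite -[LHS]/(h * 0 + y.1, h * 1 + y.2) mulr0 add0r.
Qed.

Lemma is_derive_e1 f y l :
  is_derive y e1 f l <-> is_derive y.1 (1 : R) (fun u : R => f (u, y.2)) l.
Proof.
have E := difference_quotient_e1 f y.
split => -[h1 h2]; split.
- by move: h1; rewrite /derivable E.
- by rewrite -h2 /derive E.
- by rewrite /derivable E.
- by rewrite -h2 /derive E.
Qed.

Lemma is_derive_e2 f y l :
  is_derive y e2 f l <-> is_derive y.2 (1 : R) (fun u : R => f (y.1, u)) l.
Proof.
have E := difference_quotient_e2 f y.
split => -[h1 h2]; split.
- by move: h1; rewrite /derivable E.
- by rewrite -h2 /derive E.
- by rewrite /derivable E.
- by rewrite -h2 /derive E.
Qed.

(** The two points may come in either order. *)
Lemma mean_value_any (g dg : R -> R) (a b : R) :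
  (forall u, is_derive u (1 : R) g (dg u)) ->
  exists2 c, `|c - a| <= `|b - a| & g b - g a = dg c * (b - a).
Proof.
move=> hg.
have cg := is_derive_continuous _ _ hg.
have [ab|ba] := leP a b.
  have [//|c] := @MVT_segment R g dg a b ab.
    exact: continuous_subspaceT.
  rewrite in_itv /= => /andP[ac cb] hc; exists c => //.
  by rewrite !ger0_norm ?subr_ge0// lerD2r.
have [//|c] := @MVT_segment R g dg b a (ltW ba).
  exact: continuous_subspaceT.
rewrite in_itv /= => /andP[bc ca] hc; exists c => //.
  by rewrite !ler0_norm ?subr_le0 ?(ltW ba)// !opprB lerD2l lerN2.
by rewrite -opprB hc -mulrN opprB.
Qed.

(** Split the increment into a horizontal part, treated by the mean value
    theorem and the continuity of the first partial derivative, and a vertical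
    part, which is a plain difference quotient. *)
Lemma is_derive_fan f x t s : (forall y, derivable f y e1) -> (forall y, derivable f y e2) ->
  continuous ('D_e1 f) ->
  is_derive s (1 : R) (fun u : R => f (fan x (t, u)))
    (t * 'D_e1 f (fan x (t, s)) + 'D_e2 f (fan x (t, s))).
Proof.
move=> d1 d2 c1; set p := fan x (t, s).
have pE h : fan x (t, h + s) = (p.1 + t * h, p.2 + h).
  by rewrite /p /fan /=; congr pair; ring.
move: (erefl p); rewrite {1}/p => Ep; clearbody p.
suff H : (fun h : R => h^-1 *: (((fun u : R => f (fan x (t, u))) \o shift s) (h *: (1 : R))
    - f (fan x (t, s)))) @ 0^'
    --> t * 'D_e1 f p + 'D_e2 f p.
  by split; [exact: cvgP H|exact: cvg_lim H].
have H2 : (fun h : R => h^-1 *: (f (p.1, h + p.2) - f p)) @ 0^' --> 'D_e2 f p.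
  have /is_derive_e2[h1 h2] := derivableP (d2 p).
  move: h1; rewrite /derivable -h2 /derive; under eq_fun do rewrite /= [_%:A]mulr1.
  by rewrite -surjective_pairing.
have H1 : (fun h : R => h^-1 *: (f (p.1 + t * h, h + p.2) - f (p.1, h + p.2))) @ 0^'
    --> t * 'D_e1 f p.
  apply/cvgrPdist_le => e e0.
  (* The horizontal increment is t times a derivative; t may vanish. *)
  have e'0 : 0 < e / (`|t| + 1) by rewrite divr_gt0// ltr_wpDl.
  have /cvgrPdist_le /(_ _ e'0) := c1 p.
  move=> /nbhs_ballP[r /= r0 hr].
  near=> h.
  have h0 : h != 0 by near: h; exact: nbhs_dnbhs_neq.
  have hr1 : `|h| < r.
    near: h; apply: dnbhs0_lt => //.
  have hr2 : `|h| < r / (`|t| + 1).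
    by near: h; apply: dnbhs0_lt => //; rewrite divr_gt0// ltr_wpDl.
  have [c hc ->] := @mean_value_any (fun u => f (u, h + p.2)) (fun u => 'D_e1 f (u, h + p.2))
     p.1 (p.1 + t * h) (fun u => (is_derive_e1 f (u, h + p.2) _).1 (derivableP (d1 _))).
  rewrite [p.1 + t * h]addrC addrK in hc *.
  have -> : h^-1 *: ('D_e1 f (c, h + p.2) * (t * h)) = t * 'D_e1 f (c, h + p.2).
    by rewrite /GRing.scale /=; field.
  rewrite -mulrBr normrM; apply: (@le_trans _ _ (`|t| * (e / (`|t| + 1)))).
    rewrite ler_wpM2l//; apply: hr; split; rewrite -ball_normE /ball_ /=.
      rewrite distrC (le_lt_trans hc)// normrM.
      move: hr2; rewrite ltr_pdivlMr ?ltr_wpDl//; have := normr_ge0 h; have := normr_ge0 t; nra.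
    by rewrite opprD addrCA subrr addr0 normrN.
  by rewrite mulrA ler_pdivrMr ?ltr_wpDl// mulrDr mulr1 mulrC lerDl ltW.
rewrite (_ : (fun h => _) = (fun h : R => h^-1 *: (f (p.1 + t * h, h + p.2) - f (p.1, h + p.2))
   + h^-1 *: (f (p.1, h + p.2) - f p))); first exact: cvgD.
apply/funext => h /=; rewrite Ep -scalerDr; congr (_ *: _).
by rewrite [h *: _]mulr1 pE [p.2 + _]addrC addrA subrK.
Unshelve. all: end_near. Qed.

End partial_derivatives.

(** * Functions with compact support *)

Section supports.
Context {R : realType}.
Implicit Types (f : R * R -> R) (y x : R * R) (K : set (R * R)).

Lemma continuous_compact_bound (K : set (R * R)) (g : R * R -> R) : compact K -> continuous g ->
  exists2 C : R, 0 <= C & forall y, K y -> `|g y| <= C.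
Proof.
move=> cK cg.
have : compact (g @` K) by apply: continuous_compact => //; exact: continuous_subspaceT.
move=> /compact_bounded[M0 [_ hM]].
exists (`|M0| + 1) => [|y Ky]; first by rewrite addr_ge0.
apply: (hM (`|M0| + 1)); last by exists y.
by rewrite (le_lt_trans (ler_norm _))// ltrDl.
Qed.

Definition supported_in K f := forall y, ~ K y -> f y = 0.

Lemma supported_in_derive K f v : compact K -> supported_in K f -> supported_in K ('D_v f).
Proof.
move=> cK fK y Ky.
suff fy0 : \near y, f y = (fun=> 0 : R) y by rewrite (near_eq_derive _ fy0) derive_cst.
have oK : open_nbhs y (~` K).
  by split => //; apply: closed_openC; apply: compact_closed.
by apply: filterS (open_nbhs_nbhs oK) => z; exact: fK.
Qed.

Lemma supported_in_bounded K f : compact K -> supported_in K f -> continuous f ->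
  exists2 C : R, 0 <= C & forall y, `|f y| <= C.
Proof.
move=> cK fK cf; have [C C0 hC] := continuous_compact_bound K f cK cf.
exists C => // y; have [/hC //|Ky] := pselect (K y).
by rewrite fK// normr0.
Qed.

End supports.

(** * The fundamental theorem of calculus on the whole line *)

Section ftc_line.
Context {R : realType}.
Local Notation mu := (@lebesgue_measure R).
Implicit Types (F k : R -> R) (M a b : R).

Lemma ftc_itv F k a b : a < b -> continuous k -> continuous F ->
  (forall s, a < s < b -> is_derive s (1 : R) F (k s)) ->
  (\int[mu]_(s in `[a, b]) (k s)%:E = (F b - F a)%:E)%E.
Proof.
move=> ab ck cF dF; rewrite (@continuous_FTC2 _ k F)//.
- exact: continuous_subspaceT.
- split.
  + by move=> s; rewrite in_itv /= => /dF[].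
  + by apply: cvg_at_right_filter; exact: cF.
  + by apply: cvg_at_left_filter; exact: cF.
- by move=> s; rewrite in_itv /= => /dF[_ <-]; rewrite derive1E.
Qed.

Lemma integral_derive_line F k M : continuous k ->
  (forall s, is_derive s (1 : R) F (k s)) ->
  (forall s, M < `|s| -> F s = 0) -> (forall s, M < `|s| -> k s = 0) ->
  (\int[mu]_s (k s)%:E = 0)%E.
Proof.
move=> ck dF F0 k0.
have cF := is_derive_continuous _ _ dF.
have M1 : 0 < `|M| + 1 by rewrite ltr_wpDl.
have MM : M < `|M| + 1 by rewrite (le_lt_trans (ler_norm _))// ltrDl.
transitivity (\int[mu]_(s in `[(- (`|M| + 1))%R, (`|M| + 1)%R]) (k s)%:E)%E.
  rewrite [RHS]integral_mkcond; apply: eq_integral => s _; rewrite patchE.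
  case: ifPn => //; rewrite notin_setE /= in_itv /= => /negP sM.
  rewrite k0// (lt_trans MM)// ltNge; apply: contra sM.
  by rewrite ler_norml.
rewrite (@ftc_itv F)//; last by rewrite gtrN.
by rewrite !F0 ?subrr// ?normrN ger0_norm// ltW.
Qed.

(** Each of the two half lines contributes - F(0). *)
Lemma integral_sgn_derive F k M : continuous F -> continuous k ->
  (forall s, s != 0 -> is_derive s (1 : R) F (k s)) ->
  (forall s, M < `|s| -> F s = 0) -> (forall s, M < `|s| -> k s = 0) ->
  (\int[mu]_s (Num.sg s * k s)%:E = (- 2 * F 0)%:E)%E.
Proof.
move=> cF ck dF F0 k0.
have M1 : 0 < `|M| + 1 by rewrite ltr_wpDl.
have MM : M < `|M| + 1 by rewrite (le_lt_trans (ler_norm _))// ltrDl.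
have ik a b : mu.-integrable setT ((EFin \o k) \_ `[a, b]).
  have ik' : mu.-integrable `[a, b] (EFin \o k).
    apply: continuous_compact_integrable; first exact: segment_compact.
    exact: continuous_subspaceT.
  apply: (iffLR (@integrable_mkcond _ _ R mu `[a, b]%classic (EFin \o k) _)) => //.
transitivity (\int[mu]_s (((EFin \o k) \_ `[0%R, (`|M| + 1)%R]) s
                          - ((EFin \o k) \_ `[(- (`|M| + 1))%R, 0%R]) s))%E.
  apply: eq_integral => s _; rewrite !patchE.
  have [sM|sM] := ltP M `|s|.
    by rewrite /= !k0// mulr0; do 2 case: ifP => _; rewrite ?sube0.
  have sM' := le_lt_trans sM MM.
  move: sM'; rewrite ltr_norml => /andP[s1 s2].
  have memE (a b : R) : (s \in `[a, b]%classic) = (a <= s <= b).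
    by apply/idP/idP; rewrite inE/= in_itv.
  rewrite !memE (ltW s1) (ltW s2) andbT /=; have [s0|s0|->] := ltgtP s 0.
  - by rewrite ltr0_sg// mulN1r sub0e.
  - by rewrite gtr0_sg// mul1r sube0.
  - by rewrite sgr0 mul0r subee.
rewrite integralB//= -!integral_mkcond/=.
have -> := @ftc_itv F k 0 (`|M| + 1) M1 ck cF
  (fun s h => dF s (lt0r_neq0 (proj1 (andP h)))).
have -> := @ftc_itv F k (- (`|M| + 1)) 0 _ ck cF
  (fun s h => dF s (ltr0_neq0 (proj2 (andP h)))); last by rewrite oppr_lt0.
rewrite (F0 (`|M| + 1)) ?(F0 (- (`|M| + 1))) ?normrN ?[`|_ + 1|]ger0_norm// ?ltW//.
by rewrite -EFinB; congr EFin; ring.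
Qed.

End ftc_line.

(** * The anisotropic kernel *)

Section fundamental.
Context {R : realType}.
Local Notation mu := (@lebesgue_measure R).
Local Notation plane := (measurableTypeR R * measurableTypeR R)%type.
Context (a b kap : R) (x : R * R) (a0 : 0 < a) (b0 : 0 < b) (k0 : 0 < kap).
Implicit Types (y : R * R) (f : R * R -> R) (K : set (R * R)).

Definition rsq y : R := (x.1 - y.1) ^+ 2 / a + (x.2 - y.2) ^+ 2 / b.

(** The Neumann function of the anisotropic distance, times pi. *)
Definition kernel y : R := besPhi (kap * rsq y).
(** The partial derivatives of [kernel] away from x; at x itself their value is
    0, division by 0 being 0. *)
Definition kernel_d1 y : R := 2 * besPsi (kap * rsq y) * (y.1 - x.1) / (a * rsq y).
Definition kernel_d2 y : R := 2 * besPsi (kap * rsq y) * (y.2 - x.2) / (b * rsq y).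

Lemma rsq_ge0 y : 0 <= rsq y.
Proof. by rewrite addr_ge0// divr_ge0 ?sqr_ge0// ltW. Qed.

Lemma rsq_gt0_1 y : y.1 != x.1 -> 0 < rsq y.
Proof.
move=> h; rewrite ltr_pwDl ?divr_ge0 ?sqr_ge0 ?(ltW b0)//.
by rewrite divr_gt0// exprn_even_gt0//= subr_eq0 eq_sym.
Qed.

Lemma rsq_gt0_2 y : y.2 != x.2 -> 0 < rsq y.
Proof.
move=> h; rewrite ltr_wpDl ?divr_ge0 ?sqr_ge0 ?(ltW a0)//.
by rewrite divr_gt0// exprn_even_gt0//= subr_eq0 eq_sym.
Qed.

Lemma rsq_gt0 y : y != x -> 0 < rsq y.
Proof.
have [h1|] := eqVneq y.1 x.1; last by move=> /rsq_gt0_1.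
have [h2|] := eqVneq y.2 x.2; last by move=> /rsq_gt0_2.
by rewrite [y]surjective_pairing h1 h2 -surjective_pairing eqxx.
Qed.

(** The anisotropic distance dominates the taxicab distance, which is the one
    adapted to the fan coordinates. *)
Lemma rsq_lower y : (`|y.1 - x.1| + `|y.2 - x.2|) ^+ 2 <= 2 * (a + b) * rsq y.
Proof.
rewrite /rsq -(sqrrN (x.1 - _)) -(sqrrN (x.2 - _)) !opprB.
rewrite -(real_normK (num_real (y.1 - x.1))) -(real_normK (num_real (y.2 - x.2))).
move: `|y.1 - x.1| `|y.2 - x.2| => p q.
have h1 : p ^+ 2 <= (a + b) * (p ^+ 2 / a).
  rewrite mulrDl [a * _]mulrC divfK ?gt_eqF// lerDl.
  by rewrite mulr_ge0 ?divr_ge0 ?sqr_ge0// ltW.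
have h2 : q ^+ 2 <= (a + b) * (q ^+ 2 / b).
  rewrite mulrDl [b * _]mulrC divfK ?gt_eqF// lerDr.
  by rewrite mulr_ge0 ?divr_ge0 ?sqr_ge0// ltW.
rewrite -mulrA mulrDr; have := sqr_ge0 (p - q); nra.
Qed.

Lemma continuous_rsq : continuous rsq.
Proof.
move=> y; apply: cvgD.
  apply: cvgM; last exact: cvg_cst.
  by apply: cvgM; (apply: cvgB; [exact: cvg_cst|exact: cvg_fst]).
apply: cvgM; last exact: cvg_cst.
by apply: cvgM; (apply: cvgB; [exact: cvg_cst|exact: cvg_snd]).
Qed.

Lemma continuous_krsq : continuous (fun y => kap * rsq y).
Proof. by move=> y; apply: cvgM; [exact: cvg_cst|exact: continuous_rsq]. Qed.

Lemma continuous_Psi_rsq : continuous (fun y => besPsi (kap * rsq y)).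
Proof.
move=> y; apply: (@continuous_comp _ _ _ (fun y => kap * rsq y) besPsi).
  exact: continuous_krsq.
exact: besPsi_continuous.
Qed.

Lemma measurable_kernel : measurable_fun setT (kernel : plane -> R).
Proof.
apply: (@measurableT_comp _ _ _ _ _ _ (@besPhi R)); first exact: measurable_besPhi.
exact: (continuous_measurable_fun2 _ continuous_krsq).
Qed.

Lemma measurable_kernel_d1 : measurable_fun setT (kernel_d1 : plane -> R).
Proof.
apply: measurable_funM.
  apply: (continuous_measurable_fun2 (fun y => 2 * besPsi (kap * rsq y) * (y.1 - x.1))) => y.
  apply: cvgM; last by apply: cvgB; [exact: cvg_fst|exact: cvg_cst].
  by apply: cvgM; [exact: cvg_cst|exact: continuous_Psi_rsq].
apply: measurable_invr_ge0 => [y|]; first by rewrite mulr_ge0 ?rsq_ge0// ltW.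
apply: (continuous_measurable_fun2 (fun y => a * rsq y)) => y.
by apply: cvgM; [exact: cvg_cst|exact: continuous_rsq].
Qed.

Lemma measurable_kernel_d2 : measurable_fun setT (kernel_d2 : plane -> R).
Proof.
apply: measurable_funM.
  apply: (continuous_measurable_fun2 (fun y => 2 * besPsi (kap * rsq y) * (y.2 - x.2))) => y.
  apply: cvgM; last by apply: cvgB; [exact: cvg_snd|exact: cvg_cst].
  by apply: cvgM; [exact: cvg_cst|exact: continuous_Psi_rsq].
apply: measurable_invr_ge0 => [y|]; first by rewrite mulr_ge0 ?rsq_ge0// ltW.
apply: (continuous_measurable_fun2 (fun y => b * rsq y)) => y.
by apply: cvgM; [exact: cvg_cst|exact: continuous_rsq].
Qed.

Definition taxi y : R := `|y.1 - x.1| + `|y.2 - x.2|.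

Lemma taxi_ge0 y : 0 <= taxi y. Proof. by rewrite addr_ge0. Qed.

(** The logarithm is in particular O(1/r).  At y = x the taxicab distance
    vanishes, whatever the value of the kernel. *)
Lemma kernel_bound K : compact K -> exists C : R, forall y, K y -> `|kernel y| * taxi y <= C.
Proof.
move=> cK; have [W W0 hW] := continuous_compact_bound K _ cK continuous_krsq.
have [C C0 hC] := besPhi_bound W.
exists (C * Num.sqrt (2 * (a + b) / kap)) => y Ky.
have [r0|r0] := eqVneq (rsq y) 0.
  have := rsq_lower y; rewrite r0 mulr0 => h.
  have -> : taxi y = 0 by apply/eqP; rewrite -sqrf_eq0 eq_le h sqr_ge0.
  by rewrite mulr0 mulr_ge0// sqrtr_ge0.
have rp : 0 < rsq y by rewrite lt_def r0 rsq_ge0.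
have wp : 0 < kap * rsq y by rewrite mulr_gt0.
have h1 : `|kernel y| <= C / Num.sqrt (kap * rsq y).
  by apply: hC; rewrite wp (le_trans (ler_norm _))// hW.
have h2 : taxi y <= Num.sqrt (2 * (a + b) / kap) * Num.sqrt (kap * rsq y).
  rewrite -sqrtrM ?divr_ge0 ?mulr_ge0 ?addr_ge0 ?(ltW a0) ?(ltW b0) ?(ltW k0)//.
  rewrite mulrA divfK ?gt_eqF// -[leLHS](ger0_norm (taxi_ge0 y)) -sqrtr_sqr.
  by rewrite ler_wsqrtr// rsq_lower.
apply: le_trans (ler_pM _ _ h1 h2) _ => //; first exact: taxi_ge0.
have : Num.sqrt (kap * rsq y) != 0 by rewrite gt_eqF// sqrtr_gt0.
by move: (Num.sqrt (kap * rsq y)) => q q0; rewrite mulrCA divfK// mulrC.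
Qed.

Lemma kernel_derive_bound K (c : R) (j : R * R -> R) : 0 < c -> compact K ->
  (forall y, `|j y| <= taxi y) ->
  exists C : R, forall y, K y -> `|2 * besPsi (kap * rsq y) * j y / (c * rsq y)| * taxi y <= C.
Proof.
move=> c0 cK hj.
have [P P0 hP] := continuous_compact_bound K _ cK continuous_Psi_rsq.
exists (2 * P / c * (2 * (a + b))) => y Ky.
have [r0|r0] := eqVneq (rsq y) 0.
  rewrite r0 !mulr0 invr0 mulr0 normr0 mul0r.
  by rewrite !mulr_ge0 ?invr_ge0 ?addr_ge0// ltW.
have rp : 0 < rsq y by rewrite lt_def r0 rsq_ge0.
rewrite 3!normrM normfV normrM normr_nat (gtr0_norm c0) (gtr0_norm rp).
have -> : 2 * `|besPsi (kap * rsq y)| * `|j y| / (c * rsq y) * taxi y =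
  2 / c * (`|besPsi (kap * rsq y)| * ((`|j y| * taxi y) / rsq y)).
  by field; rewrite !gt_eqF.
have -> : 2 * P / c * (2 * (a + b)) = 2 / c * (P * (2 * (a + b))) by ring.
rewrite ler_wpM2l ?divr_ge0 ?(ltW c0)// ler_pM ?hP//.
  by rewrite divr_ge0 ?(ltW rp) ?mulr_ge0 ?taxi_ge0.
rewrite ler_pdivrMr//; apply: le_trans (rsq_lower y).
by rewrite expr2 ler_wpM2r ?hj// taxi_ge0.
Qed.

Lemma kernel_d1_bound K : compact K -> exists C : R, forall y, K y -> `|kernel_d1 y| * taxi y <= C.
Proof.
by move=> cK; apply: (kernel_derive_bound K a (fun y => y.1 - x.1)) => // y; rewrite lerDl.
Qed.

Lemma kernel_d2_bound K : compact K -> exists C : R, forall y, K y -> `|kernel_d2 y| * taxi y <= C.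
Proof.
by move=> cK; apply: (kernel_derive_bound K b (fun y => y.2 - x.2)) => // y; rewrite lerDr.
Qed.

(** The form of [integrable_fan_bound] used for a singular factor h times a
    bounded factor g carried by a compact set. *)
Lemma integrable_mul_supported K (h g : R * R -> R) (G : R) : compact K ->
  measurable_fun setT (h : plane -> R) -> measurable_fun setT (g : plane -> R) ->
  (exists C : R, forall y, K y -> `|h y| * taxi y <= C) ->
  supported_in K g -> (forall y, `|g y| <= G) ->
  lebesgue2.-integrable setT (EFin \o (fun y => h y * g y) : plane -> \bar R).
Proof.
move=> cK mh mg [C hC] gK gG.
have [M M0 hM] := compact_bounded2 K cK.
have G0 : 0 <= G by apply: le_trans (gG x).
apply: (integrable_fan_bound x _ (`|C| * G) (M + (`|x.1| + `|x.2|))).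
- exact: measurable_funM.
- move=> y; have [Ky|Ky] := pselect (K y); last first.
    by rewrite gK// mulr0 normr0 mul0r mulr_ge0.
  rewrite normrM mulrAC ler_pM// ?mulr_ge0 ?addr_ge0//.
  exact: le_trans (hC y Ky) (ler_norm _).
- move=> y hy; have Ky : K y.
    by apply: contrapT => /gK g0; move: hy; rewrite g0 mulr0 eqxx.
  have [h1 h2] := hM y Ky.
  split; apply: le_trans (ler_normB _ _) _; rewrite lerD//.
    by rewrite lerDl.
  by rewrite lerDr.
Qed.

(** ** Derivatives and integration by parts *)

Lemma is_derive_quadratic (m p c k u : R) :
  is_derive u (1 : R) (fun v : R => m * ((p - v) ^+ 2 / c + k)) (m * (2 * (u - p) / c)).
Proof.
rewrite (_ : (fun v : R => _) = cst m * ((cst p - id) ^+ 2 * cst c^-1 + cst k)) //.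
by apply: is_derive_eq; rewrite !fctE /GRing.scale /=; ring.
Qed.

Lemma is_derive_kernel1 y : y != x -> is_derive y e1 kernel (kernel_d1 y).
Proof.
move=> /rsq_gt0 r0; apply/is_derive_e1.
have w0 : 0 < kap * rsq (y.1, y.2) by rewrite -surjective_pairing mulr_gt0.
have hin : is_derive y.1 (1 : R) (fun u : R => kap * rsq (u, y.2)) (kap * (2 * (y.1 - x.1) / a)).
  exact: (is_derive_quadratic kap x.1 a ((x.2 - y.2) ^+ 2 / b) y.1).
have := @is_derive1_comp R besPhi (fun u : R => kap * rsq (u, y.2)) y.1 _ _
  (is_derive_besPhi _ w0) hin.
rewrite -surjective_pairing => h; apply: is_derive_eq; rewrite /kernel_d1.
by field; rewrite !gt_eqF.
Qed.

Lemma is_derive_kernel2 y : y != x -> is_derive y e2 kernel (kernel_d2 y).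
Proof.
move=> /rsq_gt0 r0; apply/is_derive_e2.
have w0 : 0 < kap * rsq (y.1, y.2) by rewrite -surjective_pairing mulr_gt0.
have hin : is_derive y.2 (1 : R) (fun u : R => kap * rsq (y.1, u)) (kap * (2 * (y.2 - x.2) / b)).
  rewrite (_ : (fun u : R => _) =
      fun u => kap * ((x.2 - u) ^+ 2 / b + (x.1 - y.1) ^+ 2 / a)).
    exact: is_derive_quadratic.
  by apply/funext => u; rewrite /rsq addrC.
have := @is_derive1_comp R besPhi (fun u : R => kap * rsq (y.1, u)) y.2 _ _
  (is_derive_besPhi _ w0) hin.
rewrite -surjective_pairing => h; apply: is_derive_eq; rewrite /kernel_d2.
by field; rewrite !gt_eqF.
Qed.

Lemma ibp_integrable K (g : R * R -> R) (v : R * R) (dV : R * R -> R) : compact K ->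
  supported_in K g -> continuous g -> continuous ('D_v g) ->
  measurable_fun setT (dV : plane -> R) ->
  (exists C : R, forall y, K y -> `|dV y| * taxi y <= C) ->
  lebesgue2.-integrable setT
    (EFin \o (fun y => kernel y * 'D_v g y + dV y * g y) : plane -> \bar R).
Proof.
move=> cK gK cg cg1 mdV hdV.
have g1K := supported_in_derive _ _ v cK gK.
have [G _ gG] := supported_in_bounded _ _ cK gK cg.
have [G1 _ gG1] := supported_in_bounded _ _ cK g1K cg1.
have i1 := integrable_mul_supported K kernel ('D_v g) G1 cK measurable_kernel
   (continuous_measurable_fun2 _ cg1) (kernel_bound K cK) g1K gG1.
have i2 := integrable_mul_supported K dV g G cK mdV
   (continuous_measurable_fun2 _ cg) hdV gK gG.
exact: (integrableD measurableT i1 i2).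
Qed.

(** On the horizontal lines that do not contain x the integrand is the
    derivative of a compactly supported function; the remaining line is
    negligible. *)
Lemma ibp1 K (g : R * R -> R) : compact K -> supported_in K g -> continuous g ->
  (forall y, derivable g y e1) -> continuous ('D_e1 g) ->
  (\int[lebesgue2]_y (kernel y * 'D_e1 g y + kernel_d1 y * g y)%:E = 0)%E.
Proof.
move=> cK gK cg dg cg1.
have ik := ibp_integrable K g e1 kernel_d1 cK gK cg cg1 measurable_kernel_d1 (kernel_d1_bound K cK).
rewrite (integral_lebesgue2_21 _ ik) -(integral0 mu setT).
apply: (eq_integral_except x.2) => [||y2 y2x].
- exact: measurable_fubini_G ik.
- exact: measurable_cst.
have yx u : (u, y2) != x by apply: contra y2x => /eqP <-.
have dVs u : is_derive u (1 : R) (fun u => kernel (u, y2)) (kernel_d1 (u, y2)).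
  exact: ((is_derive_e1 kernel (u, y2) _).1 (is_derive_kernel1 _ (yx u))).
have dgs u : is_derive u (1 : R) (fun u => g (u, y2)) ('D_e1 g (u, y2)).
  exact: ((is_derive_e1 g (u, y2) _).1 (derivableP (dg _))).
have [M M0 hM] := compact_bounded2 K cK.
have g1K := supported_in_derive _ _ e1 cK gK.
apply: (@integral_derive_line _ (fun u => kernel (u, y2) * g (u, y2)) _ M).
- move=> u; apply: cvgD; apply: cvgM.
  + exact: is_derive_continuous dVs u.
  + exact: (continuous_slice1 _ y2 cg1).
  + apply: cvgM.
      apply: cvgM; last by apply: cvgB; [exact: cvg_id|exact: cvg_cst].
      by apply: cvgM; [exact: cvg_cst|exact: (continuous_slice1 _ y2 continuous_Psi_rsq)].
    apply: cvgV; first by rewrite mulf_neq0 ?gt_eqF// rsq_gt0.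
    by apply: cvgM; [exact: cvg_cst|exact: (continuous_slice1 _ y2 continuous_rsq)].
  + exact: (continuous_slice1 _ y2 cg).
- move=> u; apply: is_derive_eq; rewrite /GRing.scale /=; ring.
- by move=> u Mu; rewrite gK ?mulr0// => /hM[]; rewrite leNgt Mu.
- by move=> u Mu; rewrite gK ?g1K ?mulr0 ?addr0// => /hM[]; rewrite leNgt Mu.
Qed.

(** The counterpart of [ibp1] on vertical lines. *)
Lemma ibp2 K (g : R * R -> R) : compact K -> supported_in K g -> continuous g ->
  (forall y, derivable g y e2) -> continuous ('D_e2 g) ->
  (\int[lebesgue2]_y (kernel y * 'D_e2 g y + kernel_d2 y * g y)%:E = 0)%E.
Proof.
move=> cK gK cg dg cg1.
have ik := ibp_integrable K g e2 kernel_d2 cK gK cg cg1 measurable_kernel_d2 (kernel_d2_bound K cK).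
rewrite (integral_lebesgue2_12 _ ik) -(integral0 mu setT).
apply: (eq_integral_except x.1) => [||y1 y1x].
- exact: measurable_fubini_F ik.
- exact: measurable_cst.
have yx u : (y1, u) != x by apply: contra y1x => /eqP <-.
have dVs u : is_derive u (1 : R) (fun u => kernel (y1, u)) (kernel_d2 (y1, u)).
  exact: ((is_derive_e2 kernel (y1, u) _).1 (is_derive_kernel2 _ (yx u))).
have dgs u : is_derive u (1 : R) (fun u => g (y1, u)) ('D_e2 g (y1, u)).
  exact: ((is_derive_e2 g (y1, u) _).1 (derivableP (dg _))).
have [M M0 hM] := compact_bounded2 K cK.
have g1K := supported_in_derive _ _ e2 cK gK.
apply: (@integral_derive_line _ (fun u => kernel (y1, u) * g (y1, u)) _ M).
- move=> u; apply: cvgD; apply: cvgM.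
  + exact: is_derive_continuous dVs u.
  + exact: (continuous_slice2 _ y1 cg1).
  + apply: cvgM.
      apply: cvgM; last by apply: cvgB; [exact: cvg_id|exact: cvg_cst].
      by apply: cvgM; [exact: cvg_cst|exact: (continuous_slice2 _ y1 continuous_Psi_rsq)].
    apply: cvgV; first by rewrite mulf_neq0 ?gt_eqF// rsq_gt0.
    by apply: cvgM; [exact: cvg_cst|exact: (continuous_slice2 _ y1 continuous_rsq)].
  + exact: (continuous_slice2 _ y1 cg).
- move=> u; apply: is_derive_eq; rewrite /GRing.scale /=; ring.
- by move=> u Mu; rewrite gK ?mulr0// => /hM[_]; rewrite leNgt Mu.
- by move=> u Mu; rewrite gK ?g1K ?mulr0 ?addr0// => /hM[_]; rewrite leNgt Mu.
Qed.

(** ** Integration along rays *)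

(** The squared anisotropic length of the direction (t, 1). *)
Definition ray_form (t : R) : R := t ^+ 2 / a + b^-1.

Lemma ray_form_gt0 t : 0 < ray_form t.
Proof. by rewrite ltr_wpDl ?invr_gt0// divr_ge0 ?sqr_ge0// ltW. Qed.

Lemma rsq_fan t s : rsq (fan x (t, s)) = ray_form t * s ^+ 2.
Proof. by rewrite /rsq /fan /ray_form /=; field; rewrite !gt_eqF. Qed.

(** Substitute t = sqrt (a / b) u in the arctangent integral. *)
Lemma integral_ray_formV : (\int[mu]_t ((ray_form t)^-1)%:E = (pi * Num.sqrt (a * b))%:E)%E.
Proof.
have c0 : 0 < Num.sqrt (a / b) by rewrite sqrtr_gt0 divr_gt0.
have cq : continuous (fun t => (ray_form t)^-1).
  move=> t; apply: cvgV; first by rewrite gt_eqF// ray_form_gt0.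
  apply: cvgD; last exact: cvg_cst.
  by apply: cvgM; [exact: exprn_continuous|exact: cvg_cst].
rewrite (ge0_integral_affine_pos (Num.sqrt (a / b)) 0)//; last 2 first.
- by apply/measurable_EFinP; exact: continuous_measurable_fun.
- by move=> t; rewrite lee_fin invr_ge0 ltW// ray_form_gt0.
transitivity (\int[mu]_t ((Num.sqrt (a * b))%:E * ((oneDsqr t)^-1)%:E))%E.
  apply: eq_integral => t _; rewrite -!EFinM; congr EFin.
  have -> : Num.sqrt (a * b) = Num.sqrt (a / b) * b.
    rewrite -[X in _ = _ * X](ger0_norm (ltW b0)) -sqrtr_sqr -sqrtrM ?divr_ge0 ?ltW//.
    by congr Num.sqrt; field; rewrite gt_eqF.
  rewrite -mulrA; congr (_ * _).
  rewrite addr0 /ray_form exprMn sqr_sqrtr ?divr_ge0 ?ltW// /oneDsqr.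
  have : 1 + t ^+ 2 != 0 by rewrite gt_eqF// ltr_pwDl ?sqr_ge0.
  move=> h; field; rewrite h !gt_eqF//=.
rewrite ge0_integralZl ?lee_fin ?sqrtr_ge0//.
- by rewrite integral_oneDsqr -EFinM mulrC.
- apply/measurable_EFinP; apply: continuous_measurable_fun.
  exact: continuous_oneDsqrV.
Qed.

(** What is left of the Helmholtz operator tested against f once one derivative
    has been moved back to the kernel; 4 kap is lambda^2. *)
Definition radial f y : R :=
  4 * kap * (kernel y * f y) - (a * (kernel_d1 y * 'D_e1 f y) + b * (kernel_d2 y * 'D_e2 f y)).

Lemma continuous_fan (h : R * R -> R) (t : R) : continuous h ->
  continuous (fun s : R => h (fan x (t, s))).
Proof.
move=> ch s.
apply: (@continuous_comp R (R * R)%type R (fun s : R => fan x (t, s)) h); last exact: ch.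
apply: (@cvg_pair _ _ _ _ (nbhs (x.1 + t * s)) (nbhs (x.2 + s))).
  apply: cvgD; first exact: cvg_cst.
  by apply: cvgM; [exact: cvg_cst|exact: cvg_id].
by apply: cvgD; [exact: cvg_cst|exact: cvg_id].
Qed.

(** On a ray, |s| times [radial] is sgn(s) times the derivative of
    E(s) = - (2 / q) Psi(kap q s^2) f(x + (t s, s)); the terms containing Phi
    agree because Psi' = - Phi.  Then E(0) = - (2 / q) f(x) as Psi(0) = 1. *)
Lemma integral_radial_ray K f t : compact K -> supported_in K f -> continuous f ->
  (forall y, derivable f y e1) -> (forall y, derivable f y e2) ->
  continuous ('D_e1 f) -> continuous ('D_e2 f) ->
  (\int[mu]_s (fan_pull x (radial f) (t, s))%:E = (4 * f x * (ray_form t)^-1)%:E)%E.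
Proof.
move=> cK fK cf d1 d2 c1 c2.
have q0 := ray_form_gt0 t.
have kq0 : 0 < kap * ray_form t by rewrite mulr_gt0.
pose P s := besPsi (kap * ray_form t * s ^+ 2).
pose df s := t * 'D_e1 f (fan x (t, s)) + 'D_e2 f (fan x (t, s)).
pose E s := - (2 / ray_form t) * (P s * f (fan x (t, s))).
pose k s := - (2 / ray_form t) * (P s * df s
   - 2 * kap * ray_form t * ((s * besPhi (kap * ray_form t * s ^+ 2)) * f (fan x (t, s)))).
have cs : continuous (fun s : R => kap * ray_form t * s ^+ 2).
  by move=> s; apply: cvgM; [exact: cvg_cst|exact: exprn_continuous].
have cP : continuous P.
  move=> s; apply: (@continuous_comp R R R (fun s : R => kap * ray_form t * s ^+ 2) besPsi).
    exact: cs.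
  exact: besPsi_continuous.
have cE : continuous E.
  move=> s; apply: cvgM; first exact: cvg_cst.
  by apply: cvgM; [exact: cP|exact: (continuous_fan _ t cf s)].
have ck : continuous k.
  move=> s; apply: cvgM; first exact: cvg_cst.
  apply: cvgB; apply: cvgM.
  - exact: cP.
  - apply: cvgD; last exact: (continuous_fan _ t c2 s).
    by apply: cvgM; [exact: cvg_cst|exact: (continuous_fan _ t c1 s)].
  - exact: cvg_cst.
  - by apply: cvgM; [exact: (continuous_mul_besPhi _ kq0 s)|exact: (continuous_fan _ t cf s)].
have dE s : s != 0 -> is_derive s (1 : R) E (k s).
  move=> s0.
  have w0 : 0 < kap * ray_form t * s ^+ 2 by rewrite mulr_gt0// exprn_even_gt0.
  have hin : is_derive s (1 : R) (fun s : R => kap * ray_form t * s ^+ 2)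
      (kap * ray_form t * (2 * s)).
    rewrite (_ : (fun s : R => _) = cst (kap * ray_form t) * id ^+ 2) //.
    by apply: is_derive_eq; rewrite !fctE /GRing.scale /=; ring.
  have dP : is_derive s (1 : R) P
      (- besPhi (kap * ray_form t * s ^+ 2) * (kap * ray_form t * (2 * s))).
    exact: (@is_derive1_comp R besPsi (fun s : R => kap * ray_form t * s ^+ 2) s _ _
             (is_derive_besPsi _ w0) hin).
  have dfan := is_derive_fan f x t s d1 d2 c1.
  rewrite (_ : E = cst (- (2 / ray_form t)) * (P * (fun s => f (fan x (t, s))))) //.
  by apply: is_derive_eq; rewrite !fctE /k /df /GRing.scale /=; ring.
have [M M0 hM] := compact_bounded2 K cK.
have f1K := supported_in_derive _ _ e1 cK fK.
have f2K := supported_in_derive _ _ e2 cK fK.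
have outK s : M + `|x.2| < `|s| -> ~ K (fan x (t, s)).
  move=> hs /hM[_] /= h; move: hs; rewrite ltNge => /negP; apply.
  by rewrite -[s in `|s|](addKr x.2) addrC (le_trans (ler_normB _ _))// lerD.
transitivity (\int[mu]_s (Num.sg s * k s)%:E)%E.
  apply: eq_integral => s _; congr EFin.
  have [->|s0] := eqVneq s 0; first by rewrite /fan_pull sgr0 normr0 !mul0r.
  have sk : s * radial f (fan x (t, s)) = k s.
    rewrite /k /P /df /radial /kernel /kernel_d1 /kernel_d2 rsq_fan [kap * (_ * _)]mulrA.
    have -> : (fan x (t, s)).1 - x.1 = t * s by rewrite /fan /= addrC addKr.
    have -> : (fan x (t, s)).2 - x.2 = s by rewrite /fan /= addrC addKr.
    by field; rewrite s0 !gt_eqF.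
  by rewrite /fan_pull [(t, s).2]/= normrEsg -mulrA sk.
rewrite (@integral_sgn_derive _ E k (M + `|x.2|))//.
- congr EFin; rewrite /E /P expr0n mulr0 besPsi0 mul1r.
  rewrite /fan /= mulr0 !addr0 -surjective_pairing; field.
  by rewrite gt_eqF.
- by move=> s /outK hs; rewrite /E fK// !mulr0.
- by move=> s /outK hs; rewrite /k /df fK// f1K// f2K// !mulr0 addr0 mulr0 subr0 mulr0.
Qed.

Lemma integrable_radial K f : compact K -> supported_in K f -> continuous f ->
  continuous ('D_e1 f) -> continuous ('D_e2 f) ->
  lebesgue2.-integrable setT (EFin \o radial f : plane -> \bar R).
Proof.
move=> cK fK cf c1 c2.
have f1K := supported_in_derive _ _ e1 cK fK.
have f2K := supported_in_derive _ _ e2 cK fK.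
have [G _ fG] := supported_in_bounded _ _ cK fK cf.
have [G1 _ fG1] := supported_in_bounded _ _ cK f1K c1.
have [G2 _ fG2] := supported_in_bounded _ _ cK f2K c2.
have i0 := integrable_mul_supported K kernel f G cK measurable_kernel
   (continuous_measurable_fun2 _ cf) (kernel_bound K cK) fK fG.
have i1 := integrable_mul_supported K kernel_d1 _ G1 cK measurable_kernel_d1
   (continuous_measurable_fun2 _ c1) (kernel_d1_bound K cK) f1K fG1.
have i2 := integrable_mul_supported K kernel_d2 _ G2 cK measurable_kernel_d2
   (continuous_measurable_fun2 _ c2) (kernel_d2_bound K cK) f2K fG2.
exact: (integrableB measurableT (integrableZl measurableT (4 * kap) i0)
  (integrableD measurableT (integrableZl measurableT a i1) (integrableZl measurableT b i2))).
Qed.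

Lemma integral_radial K f : compact K -> supported_in K f -> continuous f ->
  (forall y, derivable f y e1) -> (forall y, derivable f y e2) ->
  continuous ('D_e1 f) -> continuous ('D_e2 f) ->
  (\int[lebesgue2]_y (radial f y)%:E = (4 * pi * Num.sqrt (a * b) * f x)%:E)%E.
Proof.
move=> cK fK cf d1 d2 c1 c2.
have ir := integrable_radial K f cK fK cf c1 c2.
have /integrableP[/measurable_EFinP mr _] := ir.
rewrite (integral_fan x _ mr) (integral_lebesgue2_12 _ (integrable_fan x _ ir)).
transitivity (\int[mu]_t ((4 * f x)%:E * ((ray_form t)^-1)%:E))%E.
  apply: eq_integral => t _; rewrite -EFinM.
  exact: (integral_radial_ray K f t cK fK cf d1 d2 c1 c2).
rewrite integralZl//.
  by rewrite integral_ray_formV -EFinM; congr EFin; ring.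
apply/integrableP; split.
  apply/measurable_EFinP; apply: continuous_measurable_fun => t.
  apply: cvgV; first by rewrite gt_eqF// ray_form_gt0.
  apply: cvgD; last exact: cvg_cst.
  by apply: cvgM; [exact: exprn_continuous|exact: cvg_cst].
under eq_integral => t _ do rewrite gee0_abs ?lee_fin ?invr_ge0 ?(ltW (ray_form_gt0 t))//.
by rewrite integral_ray_formV ltry.
Qed.

(** Adding a times [ibp1] for the first partial derivative of f and b times
    [ibp2] for the second turns the left-hand side into the integral of
    [radial]. *)
Lemma helmholtz_kernel K f : compact K -> supported_in K f -> continuous f ->
  (forall y, derivable f y e1) -> (forall y, derivable f y e2) ->
  continuous ('D_e1 f) -> continuous ('D_e2 f) ->
  (forall y, derivable ('D_e1 f) y e1) -> (forall y, derivable ('D_e2 f) y e2) ->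
  continuous ('D_e1 ('D_e1 f)) -> continuous ('D_e2 ('D_e2 f)) ->
  a * (\int[lebesgue2]_y (kernel y * 'D_e1 ('D_e1 f) y)) +
  b * (\int[lebesgue2]_y (kernel y * 'D_e2 ('D_e2 f) y)) +
  4 * kap * (\int[lebesgue2]_y (kernel y * f y)) = 4 * pi * Num.sqrt (a * b) * f x.
Proof.
move=> cK fK cf d1 d2 c1 c2 d11 d22 c11 c22.
have f1K := supported_in_derive _ _ e1 cK fK.
have f2K := supported_in_derive _ _ e2 cK fK.
have f11K := supported_in_derive _ _ e1 cK f1K.
have f22K := supported_in_derive _ _ e2 cK f2K.
have [G _ fG] := supported_in_bounded _ _ cK fK cf.
have [G1 _ fG1] := supported_in_bounded _ _ cK f1K c1.
have [G2 _ fG2] := supported_in_bounded _ _ cK f2K c2.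
have [G11 _ fG11] := supported_in_bounded _ _ cK f11K c11.
have [G22 _ fG22] := supported_in_bounded _ _ cK f22K c22.
have mc := continuous_measurable_fun2.
have i0 := integrable_mul_supported K kernel f G cK measurable_kernel
  (mc _ _ cf) (kernel_bound K cK) fK fG.
have i1 := integrable_mul_supported K kernel_d1 _ G1 cK measurable_kernel_d1
  (mc _ _ c1) (kernel_d1_bound K cK) f1K fG1.
have i2 := integrable_mul_supported K kernel_d2 _ G2 cK measurable_kernel_d2
  (mc _ _ c2) (kernel_d2_bound K cK) f2K fG2.
have i11 := integrable_mul_supported K kernel _ G11 cK measurable_kernel
  (mc _ _ c11) (kernel_bound K cK) f11K fG11.
have i22 := integrable_mul_supported K kernel _ G22 cK measurable_kernel
  (mc _ _ c22) (kernel_bound K cK) f22K fG22.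
have E1 : \int[lebesgue2]_y (kernel y * 'D_e1 ('D_e1 f) y) +
    \int[lebesgue2]_y (kernel_d1 y * 'D_e1 f y) = 0.
  rewrite -(RintegralD measurableT i11 i1).
  by rewrite /Rintegral (ibp1 K ('D_e1 f) cK f1K c1 d11 c11).
have E2 : \int[lebesgue2]_y (kernel y * 'D_e2 ('D_e2 f) y) +
    \int[lebesgue2]_y (kernel_d2 y * 'D_e2 f y) = 0.
  rewrite -(RintegralD measurableT i22 i2).
  by rewrite /Rintegral (ibp2 K ('D_e2 f) cK f2K c2 d22 c22).
have ai1 : lebesgue2.-integrable setT
    (EFin \o (fun y => a * (kernel_d1 y * 'D_e1 f y)) : plane -> \bar R) :=
  integrableZl measurableT a i1.
have bi2 : lebesgue2.-integrable setT
    (EFin \o (fun y => b * (kernel_d2 y * 'D_e2 f y)) : plane -> \bar R) :=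
  integrableZl measurableT b i2.
have ki0 : lebesgue2.-integrable setT
    (EFin \o (fun y => 4 * kap * (kernel y * f y)) : plane -> \bar R) :=
  integrableZl measurableT (4 * kap) i0.
have E0 : 4 * kap * (\int[lebesgue2]_y (kernel y * f y)) -
   (a * (\int[lebesgue2]_y (kernel_d1 y * 'D_e1 f y)) +
    b * (\int[lebesgue2]_y (kernel_d2 y * 'D_e2 f y)))
   = 4 * pi * Num.sqrt (a * b) * f x.
  rewrite -(RintegralZl (4 * kap) measurableT i0) -(RintegralZl a measurableT i1).
  rewrite -(RintegralZl b measurableT i2).
  rewrite -(RintegralD measurableT ai1 bi2).
  rewrite -(RintegralB measurableT ki0 (integrableD measurableT ai1 bi2)).
  by rewrite /Rintegral (integral_radial K f cK fK cf d1 d2 c1 c2).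
have combine (k J11 J22 J0 J1 J2 S : R) : J11 + J1 = 0 -> J22 + J2 = 0 ->
    k * J0 - (a * J1 + b * J2) = S -> a * J11 + b * J22 + k * J0 = S.
  by move=> /eqP; rewrite addr_eq0 => /eqP -> /eqP; rewrite addr_eq0 => /eqP -> <-; ring.
exact: combine E1 E2 E0.
Qed.

Lemma locally_integrable_kernel : locally_integrable2 kernel.
Proof.
split; first exact: measurable_kernel.
move=> K cK; have mK := compact_measurable2 K cK.
apply: (iffRL (@integrable_mkcond _ _ R lebesgue2 K (EFin \o kernel) mK)).
have -> : (EFin \o kernel) \_ K = (EFin \o (fun y => kernel y * \1_K y) : plane -> \bar R).
  apply/funext => y; rewrite patchE /= indicE; case: (_ \in _).
    by rewrite mulr1.
  by rewrite mulr0.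
apply: (integrable_mul_supported K kernel (\1_K) 1 cK measurable_kernel _ (kernel_bound K cK)).
- exact: measurable_indic.
- by move=> y Ky; rewrite indicE memNset.
- by move=> y; rewrite indicE; case: (_ \in _); rewrite ?normr1 ?normr0.
Qed.

End fundamental.

(** * The fundamental solution *)

Theorem mainTheorem1 (R : realType) (sl st lambda a b : R)
    (hst : 0 < st) (hsl : st < sl) (hlambda : 0 < lambda)
    (hab : (a, b) = (sl, st) \/ (a, b) = (st, sl)) :
  (forall x : R * R,
     fundamental_solution a b lambda x (ustar sl st a b lambda x)) /\
  (forall x y n : R * R, x <> y -> dotp n n = 1 ->
     [/\ derivable (ustar sl st a b lambda x) y e1,
         derivable (ustar sl st a b lambda x) y e2 &
         dotp (a * 'D_e1 (ustar sl st a b lambda x) y,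
               b * 'D_e2 (ustar sl st a b lambda x) y) n =
         lambda / (4 * Num.sqrt (sl * st)) *
         (dotp (x - y) n / rdist a b x y) *
         besselN 1 (lambda * rdist a b x y)]).
Proof.
have sl0 : 0 < sl by exact: lt_trans hsl.
have [a0 b0 abE] : [/\ 0 < a, 0 < b & a * b = sl * st].
  by case: hab => -[-> ->]; split => //; rewrite mulrC.
have kap0 : 0 < lambda ^+ 2 / 4 by rewrite divr_gt0// exprn_gt0.
set kap := lambda ^+ 2 / 4 in kap0.
pose c : R := 1 / (4 * Num.sqrt (sl * st)) / pi.
have pi0 : (pi : R) != 0 by rewrite gt_eqF// pi_gt0.
have s0 : Num.sqrt (sl * st) != 0 by rewrite gt_eqF// sqrtr_gt0 mulr_gt0.
have uE x : ustar sl st a b lambda x = fun y => c * kernel a b kap x y.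
  apply/funext => y; rewrite /ustar besselN0E; last by rewrite mulr_ge0 ?sqrtr_ge0 ?(ltW hlambda).
  have -> : (lambda * rdist a b x y) ^+ 2 / 4 = kap * rsq a b x y.
    rewrite exprMn /rdist -/(rsq a b x y) sqr_sqrtr; first by rewrite mulrAC.
    exact: rsq_ge0.
  by rewrite /c /kernel mulrA mulrAC.
split=> [x|x y n /eqP xy n1].
- split.
    have [mV iV] := locally_integrable_kernel a b kap x a0 b0 kap0.
    split; first by rewrite uE; apply: measurable_funM.
    move=> K cK; rewrite uE.
    exact: (integrableZl (compact_measurable2 K cK) c (iV K cK)).
  move=> f [Cf cK].
  have [cf [d12 [C1 C2]]] := Cf 2.
  have [c1 [d1 [[c11 _] _]]] := C1.
  have [c2 [d2 [_ [c22 _]]]] := C2.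
  have fK : supported_in (closure [set y | f y != 0]) f.
    by move=> y Ky; apply/eqP/negP => /negP fy; apply: Ky; exact: subset_closure.
  have main := helmholtz_kernel a b kap x a0 b0 kap0 _ f cK fK cf
    (fun y => (d12 y).1) (fun y => (d12 y).2) c1 c2 (fun y => (d1 y).1) (fun y => (d2 y).2) c11 c22.
  have regE K g : compact K -> supported_in K g -> continuous g ->
      regular (ustar sl st a b lambda x) g = c * \int[lebesgue2]_y (kernel a b kap x y * g y).
    move=> hK gK cg; have [G _ gG] := supported_in_bounded _ _ hK gK cg.
    have ig := integrable_mul_supported x K (kernel a b kap x) g G hK
      (measurable_kernel a b kap x) (continuous_measurable_fun2 _ cg)
      (kernel_bound a b kap x a0 b0 kap0 K hK) gK gG.
    rewrite /regular uE -(RintegralZl c measurableT ig).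
    by apply: eq_Rintegral => y _; rewrite mulrA.
  have f1K := supported_in_derive _ _ e1 cK fK.
  have f2K := supported_in_derive _ _ e2 cK fK.
  have f11K := supported_in_derive _ _ e1 cK f1K.
  have f22K := supported_in_derive _ _ e2 cK f2K.
  have helmE (T : functional) : aniso_helmholtz a b lambda T f =
      a * T ('D_e1 ('D_e1 f)) + b * T ('D_e2 ('D_e2 f)) + lambda ^+ 2 * T f.
    by congr (_ * _ + _ * _ + _); exact: opprK.
  have combine (T11 T22 T0 J11 J22 J0 S : R) : T11 = c * J11 -> T22 = c * J22 -> T0 = c * J0 ->
      a * J11 + b * J22 + 4 * kap * J0 = S -> a * T11 + b * T22 + lambda ^+ 2 * T0 = c * S.
    by move=> -> -> -> <-; rewrite /kap; field.
  rewrite helmE; transitivity (c * (4 * pi * Num.sqrt (a * b) * f x)).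
    exact: combine (regE _ _ cK f11K c11) (regE _ _ cK f22K c22) (regE _ _ cK fK cf) main.
  rewrite abE /c /delta; move: (pi : R) pi0 => p p0.
  by field; rewrite p0 s0.
- have yx : y != x by rewrite eq_sym.
  have [du1 du1E] : is_derive y e1 (ustar sl st a b lambda x) (c *: kernel_d1 a b kap x y).
    have dV := is_derive_kernel1 a b kap x a0 b0 kap0 y yx.
    by rewrite uE; apply: (@is_deriveZ _ _ _ (kernel a b kap x) c).
  have [du2 du2E] : is_derive y e2 (ustar sl st a b lambda x) (c *: kernel_d2 a b kap x y).
    have dV := is_derive_kernel2 a b kap x a0 b0 kap0 y yx.
    by rewrite uE; apply: (@is_deriveZ _ _ _ (kernel a b kap x) c).
  have r0 : 0 < rdist a b x y by rewrite sqrtr_gt0; exact: (rsq_gt0 a b x a0 b0 y yx).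
  have rE : rsq a b x y = rdist a b x y ^+ 2 by rewrite sqr_sqrtr//; exact: rsq_ge0.
  split => //; rewrite du1E du2E besselN1E ?mulr_gt0//.
  have -> : (lambda * rdist a b x y) ^+ 2 / 4 = kap * rdist a b x y ^+ 2.
    by rewrite exprMn mulrAC.
  rewrite /kernel_d1 /kernel_d2 rE /dotp /c /GRing.scale /=.
  move: (besPsi _) => P; move: (rdist a b x y) r0 (pi : R) pi0 => r r0 p p0.
  by field; rewrite s0 p0 !gt_eqF.
Qed.
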